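(* Let $A$ and $B$ be uniform algebras on compact Hausdorff spaces $X$ and $Y$, respectively, and let $S(A)$, $S(B)$ denote their unit spheres. Suppose that $T:S(A)\to S(B)$ is a surjective isometry. Then $T$ extends to a real-linear surjective isometry from $A$ onto $B$. In particular, $|T(1)|=1$ on $M_B$, and there exist a homeomorphism $\Psi:M_B\to M_A$ and possibly empty disjoint closed and open subsets $M_{B+}$ and $M_{B-}$ of $M_B$ with $M_{B+}\cup M_{B-}=M_B$ such that the map $\widetilde{T}:A\to B$ defined by $$\widetilde{T}(f)=T(1)\times\begin{cases} f\circ\Psi & \text{on } M_{B+},\\ \overline{f\circ\Psi} & \text{on } M_{B-}\end{cases}\qquad (f\in A)$$ is a (well-defined) surjective real-linear isometry from $A$ onto $B$ which extends $T$, i.e. $\widetilde{T}|_{S(A)}=T$.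
   Context: A uniform algebra on a compact Hausdorff space $X$ is a closed (in the supremum norm $\|\cdot\|$) complex subalgebra of $C(X)$, the algebra of all complex-valued continuous functions on $X$, which contains the constants and separates the points of $X$. It carries the supremum norm. The unit sphere is $S(A)=\{f\in A:\|f\|=1\}$, with the metric induced by the norm; an isometry is a distance-preserving map (no linearity assumed). $M_A$ denotes the maximal ideal space of $A$ (the space of nonzero multiplicative complex-linear functionals with the Gelfand topology). Elements $f\in A$ are identified with their Gelfand transforms and are thus also regarded as continuous functions on $M_A$, with the same notation $f$; similarly for $B$ and $M_B$. The formula for $\widetilde T(f)$ is an identity of functions on $M_B$ (i.e. it describes the Gelfand transform of the element $\widetilde T(f)\in B$). *)

(* Defs.v *)
From HB Require Import structures.
From mathcomp Require Export all_boot all_order all_algebra.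
From mathcomp Require Export complex.
From mathcomp Require Export all_classical all_reals all_analysis.

Set Implicit Arguments.
Unset Strict Implicit.
Unset Printing Implicit Defensive.

Import Order.TTheory GRing.Theory Num.Theory.
Import numFieldNormedType.Exports.

Local Open Scope classical_set_scope.
Local Open Scope ring_scope.
Local Open Scope complex_scope.

(* The norm of [R[i]] takes its values in [R[i]]; [complex.Re] brings it back to [R],
   where suprema exist. *)
Definition supnorm (R : realType) (X : Type) (f : X -> R[i]^o) : R :=
  sup [set complex.Re `|f x| | x in [set: X]].

(* [R[i]^o] rather than [R[i]]: the topology, and the structure of module over
   [R[i]], are attached to the former. Compactness and separation of [X] are
   hypotheses of the theorem. *)
Record uniformAlgebra (R : realType) (X : topologicalType) := UniformAlgebra {
  ua_set : set (X -> R[i]^o);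
  ua_continuous : forall f, ua_set f -> continuous f;
  ua_cst : forall c : R[i], ua_set (cst c);
  ua_add : forall f g, ua_set f -> ua_set g -> ua_set (f + g);
  ua_mul : forall f g, ua_set f -> ua_set g -> ua_set (f * g);
  ua_scale : forall (c : R[i]) f, ua_set f -> ua_set (c *: f);
  ua_separates : forall x y : X, x <> y -> exists2 f, ua_set f & f x <> f y;
  ua_closed : forall f, continuous f ->
    (forall e : R, 0 < e -> exists2 g, ua_set g & supnorm (f - g) < e) ->
    ua_set f }.

Section UniformAlgebraTheory.
Context (R : realType) (X : topologicalType) (A : uniformAlgebra R X).

Definition ua_pred : {pred X -> R[i]^o} := fun f => f \in ua_set A.

Lemma ua_predP f : reflect (ua_set A f) (f \in ua_pred).
Proof. by apply: (iffP idP) => [/set_mem|/mem_set]. Qed.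

Lemma ua_subring_closed : subring_closed ua_pred.
Proof.
split=> [|f g /ua_predP Af /ua_predP Ag|f g /ua_predP Af /ua_predP Ag].
- by apply/ua_predP; exact: ua_cst.
- by apply/ua_predP; rewrite -scaleN1r; apply: ua_add => //; exact: ua_scale.
- by apply/ua_predP; exact: ua_mul.
Qed.

Lemma ua_scaler_closed : GRing.scaler_closed ua_pred.
Proof. by move=> c f /ua_predP Af; apply/ua_predP; exact: ua_scale. Qed.

HB.instance Definition _ := GRing.isSubringClosed.Build _ ua_pred
  ua_subring_closed.
HB.instance Definition _ := GRing.isScaleClosed.Build _ _ ua_pred
  ua_scaler_closed.

Record ua_elt := UAElt { ua_fun :> X -> R[i]^o; ua_funP : ua_fun \in ua_pred }.

HB.instance Definition _ := [isSub for ua_fun].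
HB.instance Definition _ := [Choice of ua_elt by <:].
HB.instance Definition _ := GRing.SubChoice_isSubComPzRing.Build _ _ ua_elt
  ua_subring_closed.
HB.instance Definition _ := [SubZmodule_isSubLmodule of ua_elt by <:].

End UniformAlgebraTheory.

(* A binder [f : A] makes sense for [A : uniformAlgebra R X]. *)
Coercion ua_elt : uniformAlgebra >-> Sortclass.

Definition ua_sphere (R : realType) (X : topologicalType)
  (A : uniformAlgebra R X) : set A := [set f : A | supnorm f = 1].
Arguments ua_sphere {R X} A _.

Record maxIdealSpace (R : realType) (X : topologicalType)
    (A : uniformAlgebra R X) := MaxIdealSpace {
  mis_fun :> A -> R[i]^o;
  mis_linear : linear mis_fun;
  mis_mul : {morph mis_fun : f g / f * g};
  mis_neq0 : exists f, mis_fun f <> 0 }.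

Section GelfandTopology.
Context (R : realType) (X : topologicalType) (A : uniformAlgebra R X).

HB.instance Definition _ := gen_eqMixin (maxIdealSpace A).
HB.instance Definition _ := gen_choiceMixin (maxIdealSpace A).

(* The topology induced by the product topology, that is, the coarsest one
   making every Gelfand transform [fun phi => phi f] continuous. *)
HB.instance Definition _ := Topological.copy (maxIdealSpace A)
  (initial_topology (@mis_fun R X A : maxIdealSpace A -> {ptws A -> R[i]^o})).

End GelfandTopology.

Definition homeomorphism (M N : topologicalType) (f : M -> N) : Prop :=
  continuous f /\ exists g : N -> M, [/\ continuous g, cancel f g & cancel g f].

Section Maps.
Context (R : realType) (X Y : topologicalType).
Context (A : uniformAlgebra R X) (B : uniformAlgebra R Y).

Definition isometry_on (D : set A) (U : A -> B) : Prop :=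
  forall f g, D f -> D g -> supnorm (U f - U g) = supnorm (f - g).

Definition real_linear (U : A -> B) : Prop :=
  forall (r : R) (f g : A), U (r%:C *: f + g) = r%:C *: U f + U g.

Definition surjective_real_linear_isometry (U : A -> B) : Prop :=
  [/\ real_linear U, isometry_on [set: A] U & set_surj [set: A] [set: B] U].

End Maps.

(* Main.v *)
(* Write F(p, l) for the set of f in the unit sphere with f p = l, where p is a
   strong boundary point and |l| = 1. Two functions of the sphere are at distance
   2 exactly when they take opposite unimodular values at a common boundary
   point. Hence T maps each F(p, l) onto some F(q, m): the images of finitely many
   elements of F(p, l) share a point, because the image of their mean does.
   Distances between faces show that q depends on p only and that l |-> m is an
   isometry of the circle, so m = t l or m = t l^*. The distances from f to the
   faces F(p, l), computed with functions peaking at p, recover f p and give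
   T f q = t f(p) or t f(p)^* for every f in the sphere. Therefore the positively
   homogeneous extension U of T is a real-linear isometry, U 1 is invertible, and
   (U 1)^-1 U is a real-linear ring isomorphism; composing characters of B with it
   gives characters of A, up to conjugation. *)
Require Import Defs.
From mathcomp Require Import ring lra.
Import Order.TTheory GRing.Theory Num.Theory.
Import numFieldNormedType.Exports.
Import Normc.
Set Implicit Arguments.
Unset Strict Implicit.
Unset Printing Implicit Defensive.
Local Open Scope classical_set_scope.
Local Open Scope ring_scope.

(** * The modulus of a complex number as a real number *)

Section Modulus.
Context (R : realType).
Implicit Types z w : R[i].

Lemma normcE z : normc z = Num.sqrt (complex.Re z ^+ 2 + complex.Im z ^+ 2).
Proof. by case: z. Qed.

Lemma normc_ge0 z : 0 <= normc z.
Proof. by rewrite normcE sqrtr_ge0. Qed.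

Lemma sqr_normc z : normc z ^+ 2 = complex.Re z ^+ 2 + complex.Im z ^+ 2.
Proof. by rewrite normcE sqr_sqrtr// addr_ge0 ?sqr_ge0. Qed.

Lemma norm_normc z : `|z| = (normc z)%:C%C.
Proof. by []. Qed.

Lemma normc_eq0 z : (normc z == 0) = (z == 0).
Proof. by apply/eqP/eqP => [/eq0_normc|->]; rewrite ?normc0. Qed.

Lemma ler_normcD z w : normc (z + w) <= normc z + normc w.
Proof. exact: le_normcD. Qed.

Lemma normc_opp z : normc (- z) = normc z.
Proof. exact: normcN. Qed.

Lemma distcC z w : normc (z - w) = normc (w - z).
Proof. by rewrite -normc_opp opprB. Qed.

Lemma ler_normcB z w : normc (z - w) <= normc z + normc w.
Proof. by rewrite -(normc_opp w) ler_normcD. Qed.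

Lemma ler_distcD u z w : normc (z - w) <= normc (z - u) + normc (u - w).
Proof. by apply: le_trans (ler_normcD _ _); rewrite addrA subrK. Qed.

Lemma normcR (r : R) : normc r%:C%C = `|r|.
Proof. by rewrite normcE/= expr0n/= addr0 sqrtr_sqr. Qed.

Lemma normcX z n : normc (z ^+ n) = normc z ^+ n.
Proof. by elim: n => [|n IH]; rewrite ?expr0 ?normc1// !exprS normcM IH. Qed.

Lemma normc_conj z : normc z^* = normc z.
Proof. by case: z => a b; rewrite !normcE/= sqrrN. Qed.

Lemma normc_le_ReIm z : normc z <= `|complex.Re z| + `|complex.Im z|.
Proof.
rewrite -(@ler_pXn2r _ 2) ?nnegrE ?addr_ge0 ?normc_ge0//.
rewrite sqr_normc -[complex.Re z ^+ 2]real_normK ?num_real//.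
rewrite -[complex.Im z ^+ 2]real_normK ?num_real// sqrrD lerD2r lerDl.
by rewrite mulrn_wge0// mulr_ge0.
Qed.

Lemma ler_Re_normc z : `|complex.Re z| <= normc z.
Proof.
rewrite -(@ler_pXn2r _ 2) ?nnegrE ?normc_ge0// sqr_normc.
by rewrite real_normK ?num_real// lerDl sqr_ge0.
Qed.

Lemma ler_Im_normc z : `|complex.Im z| <= normc z.
Proof.
rewrite -(@ler_pXn2r _ 2) ?nnegrE ?normc_ge0// sqr_normc.
by rewrite real_normK ?num_real// lerDr sqr_ge0.
Qed.

Lemma complex_eqP z w :
  complex.Re z = complex.Re w -> complex.Im z = complex.Im w -> z = w.
Proof. by case: z w => [a b] [c d]/= -> ->. Qed.

Lemma ReD z w : complex.Re (z + w) = complex.Re z + complex.Re w.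
Proof. by case: z w => [a b] [c d]. Qed.
Lemma ImD z w : complex.Im (z + w) = complex.Im z + complex.Im w.
Proof. by case: z w => [a b] [c d]. Qed.
Lemma ReN z : complex.Re (- z) = - complex.Re z.
Proof. by case: z. Qed.
Lemma ImN z : complex.Im (- z) = - complex.Im z.
Proof. by case: z. Qed.
Lemma ReM z w : complex.Re (z * w) =
  complex.Re z * complex.Re w - complex.Im z * complex.Im w.
Proof. by case: z w => [a b] [c d]. Qed.
Lemma ImM z w : complex.Im (z * w) =
  complex.Re z * complex.Im w + complex.Im z * complex.Re w.
Proof. by case: z w => [a b] [c d]. Qed.
Definition ReImE := (ReD, ImD, ReN, ImN, ReM, ImM).

Lemma unimodular_neq0 z : normc z = 1 -> z != 0.
Proof. by move=> z1; rewrite -normc_eq0 z1 oner_eq0. Qed.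

(* The parallelogram law makes the unit disc strictly convex. *)
Lemma disc_strictly_convex z w : normc z <= 1 -> normc w <= 1 ->
  2 <= normc (z + w) -> z = w /\ normc z = 1.
Proof.
move=> z1 w1 zw2.
have pl : normc (z + w) ^+ 2 + normc (z - w) ^+ 2
    = 2 * normc z ^+ 2 + 2 * normc w ^+ 2.
  by rewrite !sqr_normc !ReImE; ring.
have := normc_ge0 (z - w); have := normc_ge0 z; have := normc_ge0 w.
move=> w0 z0 d0.
have d2 : normc (z - w) ^+ 2 <= 0 by nra.
have /eqP dE : normc (z - w) == 0 by rewrite -sqrf_eq0 eq_le d2 sqr_ge0.
split; first by apply/eqP; rewrite -subr_eq0 -normc_eq0 dE.
by apply/eqP; rewrite eq_le z1/=; nra.
Qed.

Lemma normc_half : normc (2^-1 : R[i]) = 2^-1.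
Proof.
have -> : (2^-1 : R[i]) = (2^-1 : R)%:C%C by rewrite fmorphV rmorph_nat.
by rewrite normcR ger0_norm// invr_ge0.
Qed.

Lemma half_sum_unimodular z w : normc z <= 1 -> normc w <= 1 ->
  normc (2^-1 * (z + w)) = 1 -> z = w /\ normc z = 1.
Proof.
move=> z1 w1; rewrite normcM normc_half => e.
by apply: disc_strictly_convex => //; lra.
Qed.

End Modulus.

(** * Continuity through real moduli, and cluster points of directed families *)

Section ContinuityC.
Context (R : realType) (X : topologicalType).

(** The norm of [R[i]] takes its values in [R[i]], so the metric definition of continuity quantifies
    over complex radii; a positive one is real, which leaves the usual real epsilon. *)
Lemma continuous_normcP (f : X -> R[i]^o) :
  continuous f <-> forall x (e : R), 0 < e ->
    \forall y \near x, normc (f y - f x) < e.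
Proof.
split=> [cf x e e0|H x].
  have /cvgrPdist_lt /(_ e%:C%C) := cf x.
  rewrite ltcE/= eqxx/= => /(_ e0).
  by apply: filterS => y; rewrite norm_normc ltcR distcC.
apply/cvgrPdist_lt => -[a b]; rewrite ltcE/= => /andP[/eqP -> a0].
have := H x _ a0; apply: filterS => y yx.
rewrite norm_normc -[(a +i* 0)%C]/(a%:C%C) ltcR distcC; exact: yx.
Qed.

Lemma continuous_normc_dist (f : X -> R[i]^o) (c : R[i]) :
  continuous f -> continuous (fun x => normc (f x - c) : R).
Proof.
move=> /continuous_normcP cf x; apply/cvgrPdist_lt => e e0.
have := cf x e e0; apply: filterS => y; apply: le_lt_trans.
have := ler_distcD (f x) (f y) c; have := ler_distcD (f y) (f x) c.
by rewrite (distcC (f x) (f y)) => h1 h2; rewrite ler_norml; apply/andP; split; lra.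
Qed.

Lemma continuous_normc (f : X -> R[i]^o) :
  continuous f -> continuous (fun x => normc (f x) : R).
Proof.
move=> cf; have := @continuous_normc_dist f 0 cf.
by under eq_fun do rewrite subr0.
Qed.

Lemma open_dist_lt (f : X -> R[i]^o) (c : R[i]) (e : R) :
  continuous f -> open [set x | normc (f x - c) < e].
Proof.
move=> cf.
apply: (@open_comp _ _ (fun x => normc (f x - c) : R) [set y | y < e]).
  by move=> x _; exact: continuous_normc_dist.
exact: open_lt.
Qed.

Lemma closed_dist_ge (f : X -> R[i]^o) (c : R[i]) (e : R) :
  continuous f -> closed [set x | e <= normc (f x - c)].
Proof.
move=> cf; rewrite -openC.
rewrite [X in open X](_ : _ = [set x | normc (f x - c) < e]); last first.
  apply/seteqP; split=> x /=; first by move/negP; rewrite -ltNge.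
  by rewrite ltNge => /negP.
exact: open_dist_lt.
Qed.

Lemma closed_dist_le (f : X -> R[i]^o) (c : R[i]) (e : R) :
  continuous f -> closed [set x | normc (f x - c) <= e].
Proof.
move=> cf.
apply: (@closed_comp _ _ (fun x => normc (f x - c) : R) [set y | y <= e]).
  by move=> x _; exact: continuous_normc_dist.
exact: closed_le.
Qed.

Lemma closed_eqc (f : X -> R[i]^o) (c : R[i]) :
  continuous f -> closed [set x | f x = c].
Proof.
move=> cf; rewrite [X in closed X](_ : _ = [set x | normc (f x - c) <= 0]).
  exact: closed_dist_le.
apply/seteqP; split=> x /= => [->|]; first by rewrite subrr normc0.
by rewrite le_eqVlt ltNge normc_ge0 orbF normc_eq0 subr_eq0 => /eqP.
Qed.

Lemma closure_min (E F : set X) y : closed F -> E `<=` F -> closure E y -> F y.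
Proof. by move=> cF /closureS EF /EF; rewrite -(proj1 (closure_id F) cF). Qed.

(** The sets [E i] form the base of a proper filter, and compactness gives it a cluster point. All
    limiting arguments on peaking functions and faces go through this form. *)
Lemma directed_cluster (I : Type) (D : set I) (E : I -> set X) :
  compact [set: X] -> D !=set0 -> (forall i, D i -> E i !=set0) ->
  (forall i j, D i -> D j -> exists2 k, D k & E k `<=` E i `&` E j) ->
  exists x, forall i, D i -> closure (E i) x.
Proof.
move=> cX D0 E0 dE.
have FF := filter_from_filter D0 dE.
have PF := filter_from_proper FF E0.
have [x [_ xc]] := cX _ PF filterT.
by exists x => i Di B nB; apply: xc => //; exists i.
Qed.

End ContinuityC.

(** * Convergence at a geometric rate *)

Section GeometricCauchy.
Context (R : realType).

(** The intervals of centre [a n] and radius [b n = 2 C 2^-n] are nested, because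
    [b n - b n.+1 = C 2^-n]; the supremum of their left ends lies in all of them. *)
Lemma geometric_cauchy_real (a : nat -> R) (C : R) :
  (forall n, `|a n.+1 - a n| <= C * 2^-1 ^+ n) ->
  exists l, forall n, `|l - a n| <= 2 * C * 2^-1 ^+ n.
Proof.
move=> aC; pose b n := 2 * C * 2^-1 ^+ n.
have bS n : b n = b n.+1 + C * 2^-1 ^+ n by rewrite /b exprS; field.
have b0 n : 0 <= b n.
  have : 0 <= C by have := aC 0; rewrite expr0 mulr1; apply: le_trans.
  by move=> C0; rewrite /b !mulr_ge0// exprn_ge0// invr_ge0.
have step n : a n - b n <= a n.+1 - b n.+1 /\ a n.+1 + b n.+1 <= a n + b n.
  by have := aC n; rewrite ler_norml bS => /andP[h1 h2]; split; lra.
have up n m : (n <= m)%N -> a n - b n <= a m - b m /\ a m + b m <= a n + b n.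
  elim: m => [|m IH]; first by rewrite leqn0 => /eqP ->.
  rewrite leq_eqVlt => /predU1P[<-//|/IH [h1 h2]].
  by have [h3 h4] := step m; split; lra.
have cross n m : a n - b n <= a m + b m.
  by have := b0 n; have := b0 m; case: (leqP n m) => [/up|/ltnW/up] [h1 h2]; lra.
pose S := [set a n - b n | n in [set: nat]].
have ubS m : ubound S (a m + b m) by move=> _ [n _ <-].
exists (sup S) => n; rewrite ler_distl; apply/andP; split.
  by apply: ub_le_sup; [exists (a n + b n)|exists n].
by apply: ge_sup => //; exists (a 0%N - b 0%N), 0%N.
Qed.

Lemma geometric_cauchy_complex (a : nat -> R[i]) (C : R) :
  (forall n, normc (a n.+1 - a n) <= C * 2^-1 ^+ n) ->
  exists l, forall n, normc (l - a n) <= 4 * C * 2^-1 ^+ n.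
Proof.
move=> aC.
have [n|x hx] := @geometric_cauchy_real (fun n => complex.Re (a n)) C.
  by apply: le_trans (aC n); rewrite -ReN -ReD ler_Re_normc.
have [n|y hy] := @geometric_cauchy_real (fun n => complex.Im (a n)) C.
  by apply: le_trans (aC n); rewrite -ImN -ImD ler_Im_normc.
exists (x +i* y)%C => n; apply: le_trans (normc_le_ReIm _) _.
rewrite !ReImE/=; have := hx n; have := hy n; lra.
Qed.

End GeometricCauchy.

Section PowersOfHalf.
Context (R : realType).

Lemma exprn_small (r e : R) : 0 <= r -> r < 1 -> 0 < e -> exists n, r ^+ n < e.
Proof.
move=> r0 r1 e0; have r1' : `|r| < 1 by rewrite ger0_norm.
have /cvgrPdist_lt /(_ e e0) [N _ /(_ N (leqnn N))] := cvg_expr r1'.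
by rewrite sub0r normrN ger0_norm ?exprn_ge0// => h; exists N.
Qed.

Lemma le_geometric_le0 (a C : R) : (forall n, a <= C * 2^-1 ^+ n) -> a <= 0.
Proof.
move=> aC; rewrite leNgt; apply/negP => a0.
have C0 : 0 < C by have := aC 0%N; rewrite expr0 mulr1; apply: lt_le_trans.
have [|||n hn] := @exprn_small 2^-1 (a / C); rewrite ?invr_ge0 ?divr_gt0//.
  by rewrite invf_lt1 ?ltr1n.
by have := aC n; rewrite leNgt mulrC -ltr_pdivlMr// hn.
Qed.

End PowersOfHalf.

(** * Peaking functions and strong boundary points *)

Section UniformAlgebra.
Context (R : realType) (X : topologicalType) (cX : compact [set: X]).
Context (A : uniformAlgebra R X).
Implicit Types (f g h : A) (x y p : X).
Local Open Scope complex_scope.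

Lemma uaD f g x : (f + g) x = (f x : R[i]) + (g x : R[i]). Proof. by []. Qed.
Lemma uaN f x : (- f) x = - (f x : R[i]). Proof. by []. Qed.
Lemma uaM f g x : (f * g) x = (f x : R[i]) * (g x : R[i]). Proof. by []. Qed.
Lemma uaZ c f x : (c *: f) x = c * (f x : R[i]). Proof. by []. Qed.
Lemma ua1 x : (1 : A) x = (1 : R[i]). Proof. by []. Qed.
Lemma ua0 x : (0 : A) x = (0 : R[i]). Proof. by []. Qed.
Lemma uaX f n x : (f ^+ n) x = (f x : R[i]) ^+ n.
Proof. by elim: n => [|n IH]; rewrite ?expr0// !exprS uaM IH. Qed.
Lemma ua_sum (I : Type) (r : seq I) (P : pred I) (F : I -> A) x :
  (\sum_(i <- r | P i) F i) x = \sum_(i <- r | P i) (F i x : R[i]).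
Proof. by elim/big_rec2: _ => [|i _ u _ <-]. Qed.
Definition uaE := (uaD, uaN, uaM, uaZ, ua1, ua0, uaX, ua_sum).

Lemma ua_eqP f g : (forall x, f x = g x) -> f = g.
Proof. by move=> fg; apply: val_inj; exact/funext. Qed.

Lemma continuous_ua f : continuous f.
Proof. by apply: (@ua_continuous _ _ A); exact/ua_predP/ua_funP. Qed.

Lemma supnorm_le_fun (h : X -> R[i]^o) (M : R) : 0 <= M ->
  (forall x, normc (h x) <= M) -> supnorm h <= M.
Proof.
move=> M0 hM; rewrite /supnorm; set S := (X in sup X).
have [->|/set0P S0] := eqVneq S set0; first by rewrite sup0.
by apply: ge_sup => // _ [x _ <-]; exact: hM.
Qed.

Lemma supnorm_le f (M : R) : 0 <= M ->
  (forall x, normc (f x) <= M) -> supnorm f <= M.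
Proof. exact: supnorm_le_fun. Qed.

Lemma supnorm_max f x0 : exists y, forall x, normc (f x) <= normc (f y).
Proof.
have [||c _ hc] := @compact_EVT_max _ R (fun x => normc (f x)) [set: X] _ cX.
- by exists x0.
- exact/continuous_subspaceT/continuous_normc/continuous_ua.
- by exists c => x; apply: hc; rewrite inE.
Qed.

Lemma ler_supnorm f x : normc (f x) <= supnorm f.
Proof.
have [y hy] := supnorm_max f x.
apply: ub_le_sup; last by exists x.
by exists (normc (f y)) => _ [z _ <-]; exact: hy.
Qed.

Lemma supnorm_ge0 f : 0 <= supnorm f.
Proof.
have [[x _]|X0] := pselect (exists x : X, True).
  by apply: le_trans (ler_supnorm f x); exact: normc_ge0.
rewrite /supnorm; set S := (X in sup X); suff -> : S = set0 by rewrite sup0.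
by rewrite -subset0 => r [x _ _]; apply: X0; exists x.
Qed.

Lemma supnorm_attained f x0 : exists x, normc (f x) = supnorm f.
Proof.
have [y hy] := supnorm_max f x0; exists y.
by apply/eqP; rewrite eq_le ler_supnorm supnorm_le// normc_ge0.
Qed.

Lemma supnorm_eq f (M : R) x :
  (forall y, normc (f y) <= M) -> M <= normc (f x) -> supnorm f = M.
Proof.
move=> hM Mx; apply/eqP; rewrite eq_le (le_trans Mx (ler_supnorm f x)) andbT.
by rewrite supnorm_le// (le_trans _ (hM x))// normc_ge0.
Qed.

Lemma supnorm0 : supnorm (0 : A) = 0.
Proof.
by apply/eqP; rewrite eq_le supnorm_ge0 supnorm_le// => x; rewrite ua0 normc0.
Qed.

Lemma supnorm_eq0 f : supnorm f = 0 -> f = 0.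
Proof.
move=> f0; apply: ua_eqP => x; have := ler_supnorm f x; rewrite f0.
by rewrite le_eqVlt ltNge normc_ge0 orbF normc_eq0 => /eqP.
Qed.

Lemma supnormZ (c : R[i]) f : supnorm (c *: f) = normc c * supnorm f.
Proof.
have [[x0 _]|X0] := pselect (exists x : X, True).
  have [x fx] := supnorm_attained f x0.
  apply: (@supnorm_eq _ _ x) => [y|]; rewrite uaZ normcM ?fx//.
  by rewrite ler_wpM2l ?normc_ge0// ler_supnorm.
have z g : supnorm g = 0.
  apply/eqP; rewrite eq_le supnorm_ge0 andbT supnorm_le// => x.
  by case: X0; exists x.
by rewrite !z mulr0.
Qed.

Lemma ua_of_fun (h : X -> R[i]^o) : continuous h ->
  (forall e : R, 0 < e -> exists g, forall x, normc (h x - g x) <= e) ->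
  exists f : A, forall x, f x = h x.
Proof.
move=> ch happ.
have Ah : ua_set A h.
  apply: ua_closed => // e e0.
  have e20 : 0 < e / 2 by rewrite divr_gt0.
  have [g hg] := happ _ e20; exists g; first exact/ua_predP/ua_funP.
  apply: (@le_lt_trans _ _ (e / 2)); last by lra.
  by apply: supnorm_le_fun hg; lra.
by have /ua_predP Ah' := Ah; exists (UAElt Ah').
Qed.

(** The pointwise limits are approached at a uniform rate, so the limit function is continuous and,
    the algebra being closed, belongs to it. *)
Lemma ua_complete (F : nat -> A) (C : R) :
  (forall n x, normc (F n.+1 x - F n x) <= C * 2^-1 ^+ n) ->
  exists G : A, forall n x, normc (G x - F n x) <= 4 * C * 2^-1 ^+ n.
Proof.
move=> FC.
have [x|h hh] := @choice X R[i] (fun x l => forall n,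
    normc (l - F n x) <= 4 * C * 2^-1 ^+ n).
  exact: (@geometric_cauchy_complex _ (fun n => F n x)).
have happ e : 0 < e -> exists n, forall x, normc (h x - F n x) <= e.
  move=> e0; have [[x0 _]|X0] := pselect (exists x : X, True); last first.
    by exists 0%N => x; case: X0; exists x.
  have [C0|C0] := leP C 0.
    exists 0%N => x; apply: le_trans (hh x 0%N) _; rewrite expr0; lra.
  have [|||n hn] := @exprn_small R 2^-1 (e / (4 * C)); rewrite ?invr_ge0//.
  - by rewrite invf_lt1 ?ltr1n.
  - by rewrite divr_gt0// mulr_gt0.
  exists n => x; apply: le_trans (hh x n) _.
  by rewrite mulrC -ler_pdivlMr ?mulr_gt0// ltW.
have ch : continuous (h : X -> R[i]^o).
  apply/continuous_normcP => x e e0.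
  have e30 : 0 < e / 3 by rewrite divr_gt0.
  have [n hn] := happ _ e30.
  have /continuous_normcP/(_ x _ e30) := @continuous_ua (F n).
  apply: filterS => y hy.
  have := ler_distcD (F n y) (h y) (h x).
  have := ler_distcD (F n x) (F n y) (h x).
  have := hn x; have := hn y; rewrite (distcC (h x)); lra.
have [|G hG] := @ua_of_fun h ch.
  by move=> e e0; have [n hn] := happ e e0; exists (F n).
by exists G => n x; rewrite hG.
Qed.

Definition peaks x : set A := [set h | (forall y, normc (h y) <= 1) /\ h x = 1].

(** Membership of [y] means that everything peaking at [x] also peaks at [y]. This is a preorder on
    the points, and strong boundary points come from its maximal elements. *)
Definition peak_class x : set X := [set y | forall h, peaks x h -> h y = 1].

(* Strong boundary points; for uniform algebras they make up the Choquet
   boundary. *)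
Definition boundary p := forall y, peak_class p y -> y = p.

Lemma peaks1 x : peaks x 1.
Proof. by split => // y; rewrite uaE normc1. Qed.

Lemma peaksM x h g : peaks x h -> peaks x g -> peaks x (h * g).
Proof.
move=> [h1 hx] [g1 gx]; split; last by rewrite uaE hx gx mulr1.
by move=> y; rewrite uaE normcM mulr_ile1 ?normc_ge0.
Qed.

Lemma peaksX x h n : peaks x h -> peaks x (h ^+ n).
Proof.
move=> hx; elim: n => [|n IH]; first by rewrite expr0; exact: peaks1.
by rewrite exprS; exact: peaksM.
Qed.

Lemma half_ball f g : (forall y, normc (f y) <= 1) ->
  (forall y, normc (g y) <= 1) -> forall y, normc ((2^-1 *: (f + g) : A) y) <= 1.
Proof.
move=> f1 g1 y; rewrite !uaE normcM normc_half.
have := ler_normcD (f y) (g y); have := f1 y; have := g1 y; lra.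
Qed.

Lemma peaks_half x h : peaks x h -> peaks x (2^-1 *: (1 + h)).
Proof.
move=> [h1 hx]; split; first by apply: half_ball => // y; rewrite uaE normc1.
by rewrite !uaE hx; field.
Qed.

(** Strict convexity of the disc. As a consequence the powers of [(1 + h) / 2] tend to 0 wherever
    [h] differs from 1. *)
Lemma half_unimodular h y : normc (h y) <= 1 ->
  1 <= normc ((2^-1 *: (1 + h) : A) y) -> h y = 1.
Proof.
rewrite !uaE normcM normc_half => h1 e.
have [|||<-//] := @disc_strictly_convex R 1 (h y); rewrite ?normc1//; lra.
Qed.

Lemma closed_peak_class x : closed (peak_class x).
Proof.
have -> : peak_class x = \bigcap_(h in peaks x) [set y | h y = 1].
  by apply/seteqP; split=> y hy h; exact: hy.
by apply: closed_bigI => h _; apply/closed_eqc/continuous_ua.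
Qed.

Lemma peak_class_refl x : peak_class x x.
Proof. by move=> h []. Qed.

Lemma peak_class_trans x y z : peak_class x y -> peak_class y z -> peak_class x z.
Proof. by move=> xy yz h hx; apply: yz; split; [case: hx|exact: xy]. Qed.

(** Otherwise the sets [E h] of points off [U] with [|h| >= e] are nonempty, and products of peaking
    functions make them directed. A common cluster point lies off [U], yet turns out to belong to
    the peak class of [x]. *)
Lemma peak_small x (U : set X) (e : R) : open U -> peak_class x `<=` U ->
  0 < e -> exists2 h, peaks x h & forall y, ~ U y -> normc (h y) < e.
Proof.
move=> oU xU e0; apply: contrapT => nex.
pose E h := [set y | ~ U y /\ e <= normc (h y)].
have [||h g hx gx|y hy] := @directed_cluster X A (peaks x) E cX.
- by exists 1; exact: peaks1.
- move=> h hx; apply: contrapT => E0; apply: nex; exists h => // y Uy.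
  by rewrite ltNge; apply/negP => hy; apply: E0; exists y.
- exists (h * g); first exact: peaksM.
  move=> y [Uy]; rewrite uaE normcM => ehg.
  have := hx.1 y; have := gx.1 y => g1 h1.
  split; split=> //; apply: le_trans ehg _.
    by rewrite ler_piMr ?normc_ge0.
  by rewrite ler_piMl ?normc_ge0.
have Ey h : peaks x h -> E h y.
  move=> hx; apply: closure_min (hy _ hx) => //.
  rewrite (_ : E h = ~` U `&` [set y | e <= normc (h y - 0)]).
    by apply: closedI; [exact: open_closedC|apply/closed_dist_ge/continuous_ua].
  by apply/seteqP; split=> z /=; rewrite subr0.
have [nUy _] := Ey _ (peaks1 x).
apply: (nUy); apply: xU => h hx.
apply: half_unimodular; first exact: hx.1.
(* All powers of [(1 + h) / 2] peak at [x], so they stay at least [e] in modulus at [y]; this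
   excludes a base of modulus below 1. *)
have px := peaks_half hx; rewrite leNgt; apply/negP => /exprn_small.
move=> /(_ e (normc_ge0 _) e0)[n].
by have [_] := Ey _ (peaksX n px); rewrite uaX normcX leNgt => /negP.
Qed.

(* Bishop's construction: [F] is the sum of [2^-(k+1) h_k f], where [h_k] peaks
   at [x] and is so small off [|f| < 1 + 2^-(k+1)] that the partial sums are
   bounded by [1 - 4^-n]. *)
Lemma peak_class_extension x f : (forall y, peak_class x y -> normc (f y) <= 1) ->
  exists F : A, (forall y, normc (F y) <= 1) /\
    (forall y, peak_class x y -> F y = f y).
Proof.
move=> f1; pose M := supnorm f + 1.
have M0 : 0 < M by have := supnorm_ge0 f; rewrite /M; lra.
have fM y : normc (f y) <= M by have := ler_supnorm f y; rewrite /M; lra.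
have half01 n : 0 < (2^-1 : R) ^+ n <= 1.
  by rewrite exprn_gt0 ?invr_gt0//= exprn_ile1// ?invr_ge0// invf_le1// ler1n.
have half2 n : ((2^-1 : R) ^+ n) ^+ 2 = 4^-1 ^+ n.
  by rewrite -exprM mulnC exprM; congr (_ ^+ n); field.
have [k|h hh] := @choice nat A (fun k h => peaks x h /\ forall y,
    1 + 2^-1 ^+ k.+1 <= normc (f y) -> normc (h y) < 4^-1 ^+ k.+1 / M).
  have [|||h hx hU] := @peak_small x [set y | normc (f y - 0) < 1 + 2^-1 ^+ k.+1]
    (4^-1 ^+ k.+1 / M).
  - by apply/open_dist_lt/continuous_ua.
  - move=> y /f1 fy /=; rewrite subr0; have := half01 k.+1; lra.
  - by rewrite divr_gt0// exprn_gt0// invr_gt0.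
  - exists h; split=> // y fy; apply: hU => /=.
    by rewrite subr0 ltNge fy.
pose S n y := \sum_(k < n) 2^-1 ^+ k.+1 * normc (h k y * f y).
have geo n : \sum_(k < n) (2^-1 : R) ^+ k.+1 = 1 - 2^-1 ^+ n.
  elim: n => [|n IH]; first by rewrite big_ord0 expr0 subrr.
  by rewrite big_ord_recr/= IH exprS; field.
have h1 k y : normc (h k y) <= 1 by case: (hh k) => -[].
have S1 n y : S n y <= 1 - 4^-1 ^+ n.
  elim: n => [|n IH]; first by rewrite /S big_ord0 expr0 subrr.
  (* With [t = 2^-(n+1)]: if [|f y| < 1 + t], the sum is at most [(1 - t) (1 + t) = 1 - 4^-(n+1)].
     Otherwise the new term is at most [4^-(n+1)], and [1 - 4^-n + 4^-(n+1) <= 1 - 4^-(n+1)]. *)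
  have [fy|fy] := ltP (normc (f y)) (1 + 2^-1 ^+ n.+1).
    apply: (@le_trans _ _ (\sum_(k < n.+1) 2^-1 ^+ k.+1 * normc (f y))).
      apply: ler_sum => k _; apply: ler_wpM2l.
        by case/andP: (half01 k.+1) => /ltW.
      by rewrite normcM ler_piMl ?normc_ge0.
    rewrite -mulr_suml geo -half2; have := half01 n.+1; have := normc_ge0 (f y).
    by move=> f0 /andP[t0 t1]; nra.
  rewrite /S big_ord_recr/= -/(S n y).
  have q0 : 0 < (4^-1 : R) ^+ n by rewrite exprn_gt0// invr_gt0.
  have : 2^-1 ^+ n.+1 * normc (h n y * f y) <= 4^-1 ^+ n.+1.
    have /andP[/ltW t0 t1] := half01 n.+1.
    rewrite -[leRHS]mul1r ler_pM ?normc_ge0//.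
    have /ltW := (hh n).2 y fy; rewrite ler_pdivlMr// normcM; apply: le_trans.
    by rewrite ler_wpM2l ?normc_ge0.
  by rewrite (exprS 4^-1); lra.
pose F n := \sum_(k < n) ((2^-1 ^+ k.+1 : R)%:C%C *: (h k * f)) : A.
have FS n y : normc (F n y) <= S n y.
  rewrite /F uaE; apply: (big_rec2 (fun (a : R[i]) b => normc a <= b)).
    by rewrite normc0.
  move=> k a b _ ab; apply: le_trans (ler_normcD _ _) _.
  by rewrite lerD// !uaE normcM normcR ger0_norm.
have [|G hG] := @ua_complete F M.
  move=> n y.
  have -> : F n.+1 y - F n y
      = (2^-1 ^+ n.+1 : R)%:C * ((h n y : R[i]) * (f y : R[i])).
    by rewrite /F big_ord_recr uaD [LHS]addrAC subrr add0r !uaE.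
  rewrite !normcM normcR.
  rewrite ger0_norm; last by case/andP: (half01 n.+1) => /ltW.
  have : normc (h n y) * normc (f y) <= M.
    by rewrite -[leRHS]mul1r ler_pM ?normc_ge0.
  have := normc_ge0 (h n y * f y); rewrite normcM.
  have /andP[t0 t1] := half01 n; rewrite exprS; nra.
exists G; split=> y.
  rewrite -subr_le0; apply: (@le_geometric_le0 _ _ (4 * M)) => n.
  have := ler_normcD (G y - F n y) (F n y); rewrite subrK.
  have := hG n y; have := FS n y; have := S1 n y.
  have : 0 <= (4^-1 : R) ^+ n by rewrite exprn_ge0// invr_ge0.
  lra.
move=> xy; apply/eqP; rewrite -subr_eq0 -normc_eq0 eq_le normc_ge0 andbT.
apply: (@le_geometric_le0 _ _ (4 * M + M)) => n.
(* On the peak class every [h k] equals 1, so the partial sums are [(1 - 2^-n) f]. *)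
have Fn : F n y = f y - (2^-1 ^+ n : R)%:C * (f y : R[i]).
  rewrite /F uaE; under eq_bigr => k _.
    rewrite !uaE (xy _ (hh k).1) mul1r; over.
  rewrite -mulr_suml -(rmorph_sum (real_complex R)) geo rmorphB rmorph1.
  by rewrite mulrBl mul1r.
have := ler_distcD (F n y) (G y) (f y); have := hG n y; rewrite Fn.
rewrite addrAC subrr sub0r normc_opp normcM normcR.
rewrite ger0_norm; last by case/andP: (half01 n) => /ltW.
have := fM y; have /andP[t0 t1] := half01 n; nra.
Qed.

(** Zorn's lemma for the preorder given by peak classes, started at [x0]. If the peak class of a
    maximal [p] had a second point [y], a function separating [p] from [y], divided by a value of
    maximal modulus on that class, would extend to [F] peaking at a point [q] of it; by maximality
    [F] is 1 at both [p] and [y], a contradiction. *)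
Lemma boundary_exists (S : set A) x0 : S `<=` peaks x0 ->
  exists2 p, boundary p & S `<=` peaks p.
Proof.
move=> Sx0.
pose T := {x | peak_class x0 x}.
pose le (s t : T) := `[< peak_class (sval s) (sval t) >].
have [||C totC|[p x0p] pmax] :=
    @ZL_preorder T (exist _ x0 (@peak_class_refl x0)) le.
- by move=> t; apply/asboolP; exact: peak_class_refl.
- by move=> r s t /asboolP rs /asboolP st; apply/asboolP/(peak_class_trans rs st).
- have [[s Cs]|C0] := pselect (C !=set0); last first.
    by exists (exist _ x0 (@peak_class_refl x0)) => s Cs; case: C0; exists s.
  (* An upper bound of a nonempty chain: a point common to its closed peak classes. *)
  have [|||y hy] := @directed_cluster X T C (fun s => peak_class (sval s)) cX.
  + by exists s.
  + by move=> t _; exists (sval t); exact: peak_class_refl.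
  + move=> t u Ct Cu; have [/asboolP tu|/asboolP ut] := totC _ _ Ct Cu.
      by exists u => // z uz; split=> //; exact: peak_class_trans tu uz.
    by exists t => // z tz; split=> //; exact: peak_class_trans ut tz.
  have Ey t : C t -> peak_class (sval t) y.
    by move=> /hy; apply: closure_min => //; exact: closed_peak_class.
  exists (exist _ y (peak_class_trans (svalP s) (Ey _ Cs))) => t Ct.
  exact/asboolP/Ey.
exists p; last by move=> f /Sx0 fx0; split; [case: fx0|exact: (x0p)].
move=> y py; apply: contrapT => yp.
have [f0 Af0 f0yp] := @ua_separates _ _ A _ _ yp.
have /ua_predP Af0' := Af0; pose f : A := UAElt Af0'.
have [|||q] := @compact_EVT_max _ R (fun x => normc (f x)) (peak_class p).
- by exists p; exact: peak_class_refl.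
- exact: (subclosed_compact (@closed_peak_class p) cX).
- exact/continuous_subspaceT/continuous_normc/continuous_ua.
rewrite inE => pq qmax.
have f_q : normc (f q) != 0.
  apply/eqP => fq0; apply: f0yp.
  have z u : peak_class p u -> f u = 0.
    move=> pu; apply/eqP; rewrite -normc_eq0 eq_le normc_ge0 andbT -fq0.
    by apply: qmax; rewrite inE.
  by rewrite -[f0 y]/(f y) -[f0 p]/(f p) !z//; exact: peak_class_refl.
have fq0 : (f q : R[i]) != 0 by rewrite -normc_eq0.
(* The quotient [f / f q] is bounded by 1 on the peak class only; the extension keeps its values
   there and is bounded by 1 everywhere. *)
have [|F [F1 FE]] := @peak_class_extension p (((f q : R[i])^-1) *: f).
  move=> u pu; rewrite uaE normcM normcV mulrC ler_pdivrMr; last first.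
    by rewrite lt_neqAle eq_sym f_q normc_ge0.
  by rewrite mul1r; apply: qmax; rewrite inE.
have Fq : peaks q F by split=> //; rewrite FE// uaE mulVf.
have /asboolP qp : le (exist _ q (peak_class_trans x0p pq)) (exist _ p x0p).
  by apply: pmax; exact/asboolP.
have := qp F Fq; have := peak_class_trans qp py Fq.
rewrite !FE//; last exact: peak_class_refl.
by move=> <- /esym; rewrite !uaE => /(mulfI (invr_neq0 fq0)).
Qed.

Lemma boundary_peak p (U : set X) (e : R) : boundary p -> open U -> U p ->
  0 < e -> exists2 h, peaks p h & forall y, ~ U y -> normc (h y) < e.
Proof.
by move=> bp oU Up e0; apply: peak_small => // y /bp ->.
Qed.

Lemma boundary_sep p q : boundary p -> p <> q ->
  exists2 h, peaks p h & h q <> 1.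
Proof.
move=> bp pq; apply: contrapT => nex; apply: pq; apply/esym/bp => h hp.
by apply: contrapT => hq; apply: nex; exists h.
Qed.

(** Divided by its value at a point of maximal modulus, [f] becomes a peaking function, and such
    functions also peak at some strong boundary point. *)
Lemma boundary_max f x0 : exists2 p, boundary p & normc (f p) = supnorm f.
Proof.
have [f0|f0] := eqVneq (supnorm f) 0.
  (* For [f = 0] no division is possible; the empty family just yields some boundary point. *)
  have [|p bp _] := @boundary_exists set0 x0; first by [].
  by exists p => //; rewrite (supnorm_eq0 f0) ua0 normc0 -f0 (supnorm_eq0 f0).
have [x fx] := supnorm_attained f x0.
have fx0 : (f x : R[i]) != 0 by rewrite -normc_eq0 fx.
have [|p bp] := @boundary_exists [set (f x : R[i])^-1 *: f] x.
  move=> _ ->; split=> [y|]; last by rewrite uaE mulVf.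
  rewrite uaE normcM normcV mulrC ler_pdivrMr ?mul1r ?fx ?ler_supnorm//.
  by rewrite lt_neqAle eq_sym f0 supnorm_ge0.
move=> /(_ _ erefl)[_]; rewrite uaE => e; exists p => //.
by rewrite -fx -[X in _ = normc X](mulr1 (f x : R[i])) -e mulVKf.
Qed.

Lemma boundary_eqP (f g : A) : (forall p, boundary p -> f p = g p) -> f = g.
Proof.
move=> fg; have [[x0 _]|X0] := pselect (exists x : X, True); last first.
  by apply: ua_eqP => x; case: X0; exists x.
apply/eqP; rewrite -subr_eq0; apply/eqP/supnorm_eq0.
have [p bp <-] := boundary_max (f - g) x0.
by rewrite !uaE fg// subrr normc0.
Qed.

Lemma boundary_supnorm_le f (M : R) : 0 <= M ->
  (forall p, boundary p -> normc (f p) <= M) -> supnorm f <= M.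
Proof.
move=> M0 fM; have [[x0 _]|X0] := pselect (exists x : X, True); last first.
  by apply: supnorm_le => // x; case: X0; exists x.
by have [p bp <-] := boundary_max f x0; exact: fM.
Qed.

End UniformAlgebra.

(** * Isometries of the circle, and points of the disc recovered from distances *)

Section Conjugation.
Context (R : realType).
Implicit Types (z w l : R[i]) (b : bool).

Definition conj_if b z : R[i] := if b then z^* else z.

Lemma conj_ifK b : involutive (conj_if b).
Proof. by case: b => z //=; rewrite conjCK. Qed.
Lemma normc_conj_if b z : normc (conj_if b z) = normc z.
Proof. by case: b => //=; rewrite normc_conj. Qed.
Lemma conj_ifD b z w : conj_if b (z + w) = conj_if b z + conj_if b w.
Proof. by case: b => //=; rewrite rmorphD. Qed.
Lemma conj_ifN b z : conj_if b (- z) = - conj_if b z.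
Proof. by case: b => //=; rewrite rmorphN. Qed.
Lemma conj_ifM b z w : conj_if b (z * w) = conj_if b z * conj_if b w.
Proof. by case: b => //=; rewrite rmorphM. Qed.
Lemma conj_ifR b (r : R) : conj_if b r%:C%C = r%:C%C.
Proof. by case: b => //=; apply: complex_eqP => //=; rewrite oppr0. Qed.

(** After division by [s 1], equality of distances becomes equality of real inner products. Pairing
    with 1 fixes the real part; pairing with the image of ['i], which is ['i] or its opposite, fixes
    the imaginary part up to one global sign. *)
Lemma circle_isometry (s : R[i] -> R[i]) :
  (forall l, normc l = 1 -> normc (s l) = 1) ->
  (forall l m, normc l = 1 -> normc m = 1 -> normc (s l - s m) = normc (l - m)) ->
  exists b, forall l, normc l = 1 -> s l = s 1 * conj_if b l.
Proof.
move=> s1 sd; have n1 : normc (1 : R[i]) = 1 := normc1 R.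
have ni : normc ('i%C : R[i]) = 1.
  by rewrite normcE/= expr0n expr1n add0r sqrtr1.
have s10 := unimodular_neq0 (s1 _ n1).
pose t l : R[i] := (s 1)^-1 * s l.
have st l : s l = s 1 * t l by rewrite /t mulVKf.
have t1 l : normc l = 1 -> normc (t l) = 1.
  by move=> l1; rewrite /t normcM normcV !s1// invr1 mulr1.
have td l m : normc l = 1 -> normc m = 1 -> normc (t l - t m) = normc (l - m).
  by move=> l1 m1; rewrite /t -mulrBr normcM normcV s1// invr1 mul1r sd.
have tt1 : t 1 = 1 by rewrite /t mulVf.
clearbody t.
have sq l : normc l = 1 -> complex.Re l ^+ 2 + complex.Im l ^+ 2 = 1.
  by move=> l1; rewrite -sqr_normc l1 expr1n.
have dsq l m : normc l = 1 -> normc m = 1 ->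
    complex.Re (t l) * complex.Re (t m) + complex.Im (t l) * complex.Im (t m)
    = complex.Re l * complex.Re m + complex.Im l * complex.Im m.
  move=> l1 m1; have /(congr1 (fun x => x ^+ 2)) := td l m l1 m1.
  rewrite !sqr_normc !ReImE; have := sq _ (t1 _ l1); have := sq _ (t1 _ m1).
  by have := sq _ l1; have := sq _ m1; lra.
have ReE l : normc l = 1 -> complex.Re (t l) = complex.Re l.
  by move=> l1; have := dsq l 1 l1 n1; rewrite tt1 /= !mulr1 !mulr0 !addr0.
have Rti : complex.Re (t 'i%C) = 0 by rewrite ReE.
have Iti : complex.Im (t 'i%C) ^+ 2 = 1.
  by have := sq _ (t1 _ ni); rewrite Rti expr0n add0r.
have ImE l : normc l = 1 -> complex.Im (t l) * complex.Im (t 'i%C) = complex.Im l.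
  by move=> l1; have := dsq l _ l1 ni; rewrite Rti /= !mulr0 mulr1 !add0r.
move/eqP: Iti; rewrite sqrf_eq1 => /orP[]/eqP ti.
  exists false => l l1; rewrite st; congr (_ * _).
  by apply: complex_eqP; [exact: ReE|rewrite -[RHS]ImE// ti mulr1].
exists true => l l1; rewrite st; congr (_ * _).
have ReJ : complex.Re (conj_if true l) = complex.Re l by case: (l).
have ImJ : complex.Im (conj_if true l) = - complex.Im l by case: (l).
apply: complex_eqP; first by rewrite ReE.
by rewrite ImJ -(ImE _ l1) ti mulrN1 opprK.
Qed.

(* Only unimodular [l] opposite to [z] or [w] matter; they see the modulus and
   the direction. *)
Lemma eq_from_distances z w : normc z <= 1 -> normc w <= 1 ->
  (forall l, normc l = 1 -> normc (w - l) <= Num.max 1 (normc (z - l))) ->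
  (forall l, normc l = 1 -> normc (z - l) <= Num.max 1 (normc (w - l))) ->
  w = z.
Proof.
(* Take [l = - u / |u|]: then [|u - l| = 1 + |u|] exceeds 1, so the maximum must be [|v - l|]. *)
have far u v : u != 0 ->
    (forall l, normc l = 1 -> normc (u - l) <= Num.max 1 (normc (v - l))) ->
    1 + normc u <= normc (v + u / (normc u)%:C%C).
  move=> u0 H; have nu0 : 0 < normc u.
    by rewrite lt_neqAle eq_sym normc_eq0 u0 normc_ge0.
  have nuC : (normc u)%:C%C != 0 :> R[i] by rewrite -normc_eq0 normcR normr_eq0 gt_eqF.
  have /H : normc (- (u / (normc u)%:C%C)) = 1.
    by rewrite normc_opp normcM normcV normcR gtr0_norm// divff// gt_eqF.
  rewrite !opprK; have -> : normc (u + u / (normc u)%:C%C) = 1 + normc u.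
    have -> : u + u / (normc u)%:C%C = u / (normc u)%:C%C * (1 + (normc u))%:C%C.
      by rewrite rmorphD rmorph1 mulrDr mulr1 divfK// addrC.
    rewrite normcM normcM normcV !normcR gtr0_norm// divff ?gt_eqF// mul1r.
    by rewrite gtr0_norm//; lra.
  by rewrite le_max => /orP[|//]; lra.
have le u v : u != 0 ->
    (forall l, normc l = 1 -> normc (u - l) <= Num.max 1 (normc (v - l))) ->
    normc u <= normc v.
  move=> u0 /(far _ _ u0) h; have := ler_normcD v (u / (normc u)%:C%C).
  rewrite normcM normcV normcR ger0_norm ?normc_ge0// divff ?normc_eq0//; lra.
move=> z1 w1 Hw Hz; have [w0|w0] := eqVneq w 0.
  rewrite w0; apply/esym/eqP/negPn/negP => z0.
  by have := le z w z0 Hz; rewrite w0 normc0 leNgt lt_neqAle eq_sym normc_eq0 z0 normc_ge0.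
have wz := le w z w0 Hw.
have z0 : z != 0.
  by apply: contraNneq w0 => z0; rewrite -normc_eq0 eq_le normc_ge0 -(normc0 R) -z0 wz.
have zw := le z w z0 Hz.
have e : normc w = normc z by apply/eqP; rewrite eq_le wz zw.
have := far w z w0 Hw; set r := normc w => h.
have r0 : 0 < r by rewrite lt_neqAle eq_sym normc_eq0 w0 normc_ge0.
have rC : r%:C%C != 0 :> R[i] by rewrite -normc_eq0 normcR normr_eq0 gt_eqF.
have nu : normc (z / r%:C%C) = 1.
  by rewrite normcM normcV normcR gtr0_norm// -e divff// gt_eqF.
have nv : normc (w / r%:C%C) = 1.
  by rewrite normcM normcV normcR gtr0_norm// divff// gt_eqF.
have [|||zwE _] := @disc_strictly_convex R (z / r%:C%C) (w / r%:C%C).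
- by rewrite nu.
- by rewrite nv.
(* With equal moduli [r], [far] reads [1 + r <= |z + w / r|]. This decomposition turns it into
   [2 <= |z / r + w / r|], and strict convexity applies. *)
- have : z + w / r%:C%C = r%:C%C * (z / r%:C%C + w / r%:C%C)
      + (1 - r)%:C%C * (w / r%:C%C).
    by rewrite rmorphB rmorph1; field.
  move=> E; rewrite E in h.
  have := ler_normcD (r%:C%C * (z / r%:C%C + w / r%:C%C)) ((1 - r)%:C%C * (w / r%:C%C)).
  rewrite !(normcM r%:C%C) !(normcM (1 - r)%:C%C) nv !normcR (gtr0_norm r0).
  rewrite ger0_norm; last by rewrite subr_ge0.
  by move=> h2; rewrite -(ler_pM2l r0); lra.
by apply: (mulIf (invr_neq0 rC)).
Qed.

End Conjugation.

(** * Faces of the unit sphere and the distances between them *)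

Section Sphere.
Context (R : realType) (X : topologicalType) (cX : compact [set: X]).
Context (A : uniformAlgebra R X).
Implicit Types (f g h : A) (p x : X).

Lemma sphere_le1 f x : ua_sphere A f -> normc (f x) <= 1.
Proof. by move=> <-; exact: ler_supnorm. Qed.

Lemma sphere_point f : ua_sphere A f -> exists x, normc (f x) = 1.
Proof.
move=> f1; have [[x0 _]|X0] := pselect (exists x : X, True).
  by have [x fx] := supnorm_attained cX f x0; exists x; rewrite fx.
have : supnorm f <= 0 by apply: supnorm_le => // x; case: X0; exists x.
by rewrite [supnorm f]f1 ler10.
Qed.

Lemma sphereI f x : (forall y, normc (f y) <= 1) -> normc (f x) = 1 ->
  ua_sphere A f.
Proof. by move=> f1 fx; apply: (supnorm_eq cX f1 (x := x)); rewrite fx. Qed.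

Lemma peaks_sphere (c : R[i]) x h : normc c = 1 -> peaks x h ->
  ua_sphere A (c *: h) /\ (c *: h) x = c.
Proof.
move=> c1 [h1 hx]; split; last by rewrite uaE hx mulr1.
by apply: (@sphereI _ x) => [y|]; rewrite uaE normcM c1 mul1r// hx normc1.
Qed.

Lemma cst_sphere (c : R[i]) x : normc c = 1 -> ua_sphere A (c *: (1 : A)).
Proof. by move=> c1; have [] := peaks_sphere c1 (@peaks1 R X A x). Qed.

(** At a point where [f - g] attains its norm 2, strict convexity of the disc makes [f] and [- g]
    equal and unimodular. *)
Lemma dist2P f g : ua_sphere A f -> ua_sphere A g ->
  supnorm (f - g) = 2 <-> exists2 x, normc (f x) = 1 & g x = - (f x : R[i]).
Proof.
move=> f1 g1; split=> [fg2|[x fx gx]].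
  have [x0 _] := sphere_point f1.
  have [x fgx] := supnorm_attained cX (f - g) x0.
  rewrite fg2 !uaE in fgx.
  have [|||fE nf] := @disc_strictly_convex R (f x) (- (g x : R[i])).
  - exact: sphere_le1.
  - by rewrite normc_opp; exact: sphere_le1.
  - by rewrite fgx.
  by exists x => //; rewrite [in RHS]fE opprK.
apply: (supnorm_eq cX (x := x)) => [y|]; rewrite !uaE.
  have := ler_normcB (f y) (g y).
  have := sphere_le1 y f1; have := sphere_le1 y g1; lra.
have -> : (f x : R[i]) - (g x : R[i]) = 2 * (f x : R[i]) by rewrite gx; ring.
rewrite normcM fx mulr1.
by have := normc_half R; rewrite normcV => /invr_inj ->.
Qed.

(** The constant [l] shows that [l' = l]; then [l *: h], for [h] peaking at [p], shows that
    [h p' = 1], so [p'] is in the peak class of [p]. *)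
Lemma face_unique p p' (l l' : R[i]) : boundary A p -> normc l = 1 ->
  (forall f, ua_sphere A f -> f p = l -> f p' = l') -> p' = p.
Proof.
move=> bp l1 H; apply: bp => h hp.
have := H _ (cst_sphere p l1); rewrite !uaE mulr1 => /(_ erefl) lE.
have [sh hpl] := peaks_sphere l1 hp.
have := H _ sh hpl; rewrite uaE -lE -[X in _ = X]mulr1.
by move/(mulfI (unimodular_neq0 l1)).
Qed.

(** Multiples of functions peaking at [p] and at [p'] are taken, each below [e] off a neighbourhood
    of its own point; the neighbourhoods being disjoint, at most one of the two is large at any
    point. *)
Lemma face_far p p' (l l' : R[i]) (e : R) : boundary A p -> boundary A p' ->
  p <> p' -> normc l = 1 -> normc l' = 1 -> 0 < e ->
  exists f f', [/\ ua_sphere A f, ua_sphere A f', f p = l, f' p' = l' &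
    supnorm (f - f') <= 1 + e].
Proof.
move=> bp bp' pp' l1 l1' e0.
have [k [_ kp] kp'] := boundary_sep bp pp'.
(* Half the distance between [k p = 1] and [k p'], so that the two neighbourhoods cut out by [k] are
   disjoint. *)
pose d := normc (1 - k p') / 2.
have d0 : 0 < d.
  rewrite divr_gt0// lt_neqAle eq_sym normc_eq0 subr_eq0 normc_ge0 andbT.
  by apply/eqP => kE; apply: kp'.
have [||h hp hU] := @boundary_peak R X cX A p [set y | normc (k y - 1) < d] e bp _ _ e0.
- exact/open_dist_lt/continuous_ua.
- by rewrite /= kp subrr normc0.
have [||h' hp' hU'] := @boundary_peak R X cX A p'
    [set y | normc (k y - k p') < d] e bp' _ _ e0.
- exact/open_dist_lt/continuous_ua.
- by rewrite /= subrr normc0.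
have [sf fp] := peaks_sphere l1 hp; have [sf' fp'] := peaks_sphere l1' hp'.
exists (l *: h), (l' *: h'); split=> //.
apply: supnorm_le => [|y]; first by lra.
have -> : (l *: h - l' *: h') y = l * (h y : R[i]) - l' * (h' y : R[i]) by [].
apply: le_trans (ler_normcB _ _) _; rewrite !normcM l1 l1' !mul1r.
have [yU|yU] := ltP (normc (k y - 1)) d.
  rewrite lerD//; first exact: hp.1.
  apply/ltW/hU' => /=; have := ler_distcD (k y) 1 (k p').
  rewrite (distcC 1 (k y)) => h1 h2.
  by move: d0 yU h2 h1; rewrite /d; lra.
rewrite [leRHS]addrC lerD//; last exact: hp'.1.
by apply/ltW/hU => /=; rewrite ltNge yU.
Qed.

(* Averaging [N] peaking functions with nested transition regions gives a peaking
   function whose values are within [1/N + e] of the segment [0, 1]. *)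
Lemma near_real_peak p (e : R) (N : nat) (U : set X) : boundary A p -> 0 < e ->
  open U -> U p ->
  exists H : A, [/\ H p = (N%:R : R)%:C%C,
    forall y, normc (H y) <= N%:R,
    forall y, exists2 t : R, 0 <= t <= N%:R &
      normc (H y - t%:C%C) <= 1 + N%:R * e &
    forall y, ~ U y -> normc (H y) <= N%:R * e].
Proof.
move=> bp e0; elim: N U => [|N IH] U oU Up.
  exists 0; split=> [|y|y|y _]; rewrite ?uaE ?normc0 ?mul0r//.
  by exists 0; rewrite ?lexx// subrr normc0 addr0.
have [h hp hU] := boundary_peak cX bp oU Up e0.
(* The remaining [N] functions are built on [V]: there [h] is close to 1 and adds 1 to the real
   approximation; off [V] their sum is at most [N e], and 0 approximates within [1 + N e]. *)
pose V := U `&` [set y | normc (h y - 1) < e].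
have [||H [Hp HN Hr HV]] := IH V.
- by apply: openI => //; apply/open_dist_lt/continuous_ua.
- by split=> //=; rewrite hp.2 subrr normc0.
exists (h + H); split=> [|y|y|y Uy]; rewrite uaE.
- by rewrite hp.2 Hp -[N.+1]add1n natrD rmorphD rmorph1.
- apply: le_trans (ler_normcD _ _) _.
  by rewrite -[N.+1]add1n natrD lerD//; exact: hp.1.
- have [Vy|Vy] := pselect (V y).
    have [t t0N tH] := Hr y; exists (1 + t).
      by rewrite -[N.+1]add1n natrD; case/andP: t0N => t0 tN; apply/andP; split; lra.
    have -> : (h y : R[i]) + (H y : R[i]) - (1 + t)%:C%C
        = (h y - 1) + (H y - t%:C%C) by rewrite rmorphD rmorph1; ring.
    have := ler_normcD (h y - 1) (H y - t%:C%C).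
    by case: Vy => _ /= hy; rewrite -[N.+1]add1n natrD mulrDl mul1r; lra.
  exists 0; first by rewrite lexx ler0n.
  rewrite subr0; have := ler_normcD (h y) (H y); have := hp.1 y; have := HV _ Vy.
  by rewrite -[N.+1]add1n natrD mulrDl mul1r; lra.
- have := ler_normcD (h y) (H y); have := hU _ Uy.
  have /HV : ~ V y by case.
  by rewrite -[N.+1]add1n natrD mulrDl mul1r; lra.
Qed.

(** The choice is [g = l *: h], with [h] peaking at [p] and nearly valued in [0, 1]. Near [p] the
    difference [f - g] is close to the segment from [f p] to [f p - l]; elsewhere [h] is small and
    [|f| <= 1]. *)
Lemma face_near f p (l : R[i]) (e : R) : ua_sphere A f -> boundary A p ->
  normc l = 1 -> 0 < e ->
  exists g, [/\ ua_sphere A g, g p = l &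
    supnorm (f - g) <= Num.max 1 (normc (f p - l)) + e].
Proof.
move=> f1 bp l1 e0; have e30 : 0 < e / 3 by rewrite divr_gt0.
have [|||n hn] := @exprn_small R 2^-1 (e / 3); rewrite ?invr_ge0//.
  by rewrite invf_lt1 ?ltr1n.
(* The values of [h] are within [1/N + e/3] of [0, 1], hence within [2e/3]; the variation of [f]
   takes up the last third. *)
pose N := (2 ^ n)%N; have N0 : 0 < N%:R :> R by rewrite ltr0n expn_gt0.
have NV : N%:R^-1 < e / 3 by rewrite /N natrX -exprVn.
have [||H [Hp HN Hr HU]] := @near_real_peak p (e / 3) N
  [set y | normc (f y - f p) < e / 3] bp e30.
- exact/open_dist_lt/continuous_ua.
- by rewrite /= subrr normc0.
have nNV : normc (N%:R^-1 : R)%:C%C = N%:R^-1.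
  by rewrite normcR ger0_norm// invr_ge0 ltW.
pose h := (N%:R^-1 : R)%:C%C *: H : A.
have hp : peaks p h.
  split=> [y|]; rewrite uaE.
    by rewrite normcM nNV ler_pdivrMl// mulr1.
  by rewrite Hp -rmorphM mulVf ?gt_eqF.
have [sg gp] := peaks_sphere l1 hp.
exists (l *: h); split=> //.
set M := Num.max _ _; have M1 : 1 <= M by rewrite le_max lexx.
have Mz : normc (f p - l) <= M by rewrite le_max lexx orbT.
apply: supnorm_le => [|y]; first by lra.
have -> : (f - l *: h) y = (f y : R[i]) - l * (h y : R[i]) by [].
have [yU|yU] := ltP (normc (f y - f p)) (e / 3); last first.
  have hy : normc (h y) <= e / 3.
    rewrite uaE normcM nNV ler_pdivrMl//; apply: HU => /=.
    by apply/negP; rewrite -leNgt.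
  have := ler_normcB (f y) (l * (h y : R[i])); rewrite normcM l1 mul1r.
  by have := sphere_le1 y f1; lra.
have [t /andP[t0 tN] tH] := Hr y; pose s := N%:R^-1 * t.
have s0 : 0 <= s by rewrite mulr_ge0// invr_ge0 ltW.
have s1 : s <= 1 by rewrite ler_pdivrMl// mulr1.
have hs : normc (h y - s%:C%C) <= e / 3 + e / 3.
  have -> : (h y : R[i]) - s%:C%C = (N%:R^-1 : R)%:C%C * ((H y : R[i]) - t%:C%C).
    by rewrite uaE mulrBr -rmorphM.
  rewrite normcM nNV ler_pdivrMl//; apply: le_trans tH _.
  have : 1 <= N%:R * (e / 3) by rewrite -ler_pdivrMl// mulr1 ltW.
  by lra.
(* A convex combination of [f p], of modulus at most 1, and [f p - l]. *)
have Ms : normc (f p - l * s%:C%C) <= M.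
  have -> : (f p : R[i]) - l * s%:C%C = (1 - s)%:C%C * (f p : R[i]) + s%:C%C * (f p - l).
    by rewrite rmorphB rmorph1; ring.
  apply: le_trans (ler_normcD _ _) _; rewrite !normcM !normcR.
  rewrite (ger0_norm s0) ger0_norm; last by lra.
  by have := sphere_le1 p f1; nra.
have -> : (f y : R[i]) - l * (h y : R[i])
    = (f y - f p) + (f p - l * s%:C%C) - l * (h y - s%:C%C) by ring.
apply: le_trans (ler_normcB _ _) _; rewrite normcM l1 mul1r.
by have := ler_normcD (f y - f p) (f p - l * s%:C%C); lra.
Qed.

End Sphere.

(** The maps are total, but only their values on the spheres matter. Carrying the inverse along
    makes the situation symmetric, so each result also applies to [T']. *)
Definition sphere_isometries (R : realType) (X Y : topologicalType)
    (A : uniformAlgebra R X) (B : uniformAlgebra R Y) (T : A -> B) (T' : B -> A) :=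
  [/\ set_fun (ua_sphere A) (ua_sphere B) T,
      set_fun (ua_sphere B) (ua_sphere A) T',
      isometry_on (ua_sphere A) T,
      forall f, ua_sphere A f -> T' (T f) = f &
      forall g, ua_sphere B g -> T (T' g) = g].

(** * The image of a face lies in a face *)

Section SphereIsometry.
Context (R : realType) (X Y : topologicalType).
Context (cX : compact [set: X]) (cY : compact [set: Y]).
Context (A : uniformAlgebra R X) (B : uniformAlgebra R Y).
Context (T : A -> B) (T' : B -> A) (TT' : sphere_isometries T T').

Lemma sphere_isometries_sym : sphere_isometries T' T.
Proof.
case: TT' => Tf T'f Ti TK T'K; split=> // f g sf sg.
by rewrite -Ti ?T'K//; exact: T'f.
Qed.

Let T_sphere f (sf : ua_sphere A f) : ua_sphere B (T f).
Proof. by case: TT' => H _ _ _ _; exact: H. Qed.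
Let T'_sphere g (sg : ua_sphere B g) : ua_sphere A (T' g).
Proof. by case: TT' => _ H _ _ _; exact: H. Qed.
Let T_iso f g : ua_sphere A f -> ua_sphere A g ->
  supnorm (T f - T g) = supnorm (f - g).
Proof. by case: TT' => _ _ H _ _; exact: H. Qed.
Let T'K g : ua_sphere B g -> T (T' g) = g.
Proof. by case: TT' => _ _ _ _; exact. Qed.

(* Being at distance 2 from the midpoint of [f] and [g] implies being at distance
   2 from [f]; test this against the opposite of a function peaking at [q]. *)
Lemma midpoint_image f g q : ua_sphere A f -> ua_sphere A g ->
  ua_sphere A (2^-1 *: (f + g)) -> boundary B q ->
  normc (T (2^-1 *: (f + g)) q) = 1 -> T f q = T (2^-1 *: (f + g)) q.
Proof.
set m := 2^-1 *: (f + g) => sf sg sm bq; set mu : R[i] := T m q => mu1.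
apply: contrapT => Tfq; pose d := normc (T f q - mu).
have d0 : 0 < d.
  rewrite lt_neqAle eq_sym normc_eq0 subr_eq0 normc_ge0 andbT.
  by apply/eqP.
have [||h hq hW] := @boundary_peak R Y cY B q [set y | normc (T f y - T f q) < d]
    1 bq _ _ ltr01.
- exact/open_dist_lt/continuous_ua.
- by rewrite /= subrr normc0.
have mu1' : normc (- mu) = 1 by rewrite normc_opp.
(* Averaging [h] with 1 makes [k] unimodular only where [h = 1], hence only inside the neighbourhood
   where [T f] is within [d] of [T f q]. *)
have [sk kq] := peaks_sphere cY mu1' (peaks_half hq).
set k := - mu *: _ in sk kq.
have mk2 : supnorm (m - T' k) = 2.
  rewrite -T_iso ?T'K//; last exact: T'_sphere.
  by apply/(dist2P cY (T_sphere sm) sk); exists q => //; rewrite kq.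
have [x mx k'x] := (dist2P cX sm (T'_sphere sk)).1 mk2.
have fk2 : supnorm (T f - k) = 2.
  have -> : supnorm (T f - k) = supnorm (f - T' k).
    by rewrite -T_iso ?T'K//; exact: T'_sphere.
  apply/(dist2P cX sf (T'_sphere sk)); exists x.
    by have [||] := @half_sum_unimodular R (f x) (g x) _ _ mx; try exact: sphere_le1.
  rewrite k'x; congr (- _); rewrite uaZ uaD.
  have [||<- _] := @half_sum_unimodular R (f x) (g x) _ _ mx; try exact: sphere_le1.
  by field.
(* At this point [k] is unimodular, so [h y = 1] and [T f y = mu], although [y] lies in a
   neighbourhood where [T f] stays away from [mu]. *)
have [y Tfy ky] := (dist2P cY (T_sphere sf) sk).1 fk2.
have hy : h y = 1.
  apply: half_unimodular; first exact: hq.1.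
  have : normc (k y) = 1 by rewrite ky normc_opp.
  by rewrite uaE normcM mu1' mul1r => ->.
have Wy : normc (T f y - T f q) < d.
  apply: contrapT => /hW; by rewrite hy normc1 ltxx.
have TfyE : T f y = mu.
  apply: oppr_inj; rewrite -ky !uaE hy.
  by field.
by move: Wy; rewrite TfyE distcC ltxx.
Qed.

(** The sets [E f] of boundary points where [T f] is unimodular are nonempty, and directed through
    midpoints. At a common cluster point all the [T f] take the same unimodular value. *)
Lemma face_image p (l : R[i]) : boundary A p -> normc l = 1 ->
  exists q (m : R[i]), [/\ boundary B q, normc m = 1 &
    forall f, ua_sphere A f -> f p = l -> T f q = m].
Proof.
move=> bp l1; pose D := [set f | ua_sphere A f /\ f p = l].
pose E f := [set q | boundary B q /\ normc (T f q) = 1].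
have D1 : D (l *: (1 : A)).
  by split; [exact: (cst_sphere cX A p)|rewrite !uaE mulr1].
have Dm f g : D f -> D g -> D (2^-1 *: (f + g)).
  move=> [sf fp] [sg gp].
  have mp : (2^-1 *: (f + g)) p = l by rewrite !uaE fp gp; field.
  split=> //; apply: (sphereI cX (x := p)); last by rewrite mp.
  by apply: half_ball => y; exact: sphere_le1.
have Em f g : D f -> D g -> E (2^-1 *: (f + g)) `<=` [set q | T f q = T g q].
  move=> Df Dg q [bq q1] /=; have [sm _] := Dm _ _ Df Dg.
  rewrite (midpoint_image Df.1 Dg.1 sm bq q1).
  by rewrite addrC in sm q1 *; rewrite (midpoint_image Dg.1 Df.1 sm bq q1).
have [||f g Df Dg|y hy] := @directed_cluster Y A D E cY.
- by exists (l *: (1 : A)).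
- move=> f [sf _]; have [y0 _] := sphere_point cY (T_sphere sf).
  by have [q bq] := boundary_max cY (T f) y0; rewrite (T_sphere sf) => q1; exists q.
- exists (2^-1 *: (f + g)); first exact: Dm.
  move=> q [bq q1]; have [sm _] := Dm _ _ Df Dg; split; split=> //.
    by rewrite (midpoint_image Df.1 Dg.1 sm bq q1).
  by rewrite addrC in sm q1; rewrite (midpoint_image Dg.1 Df.1 sm bq q1).
have Ty f : D f -> T f y = T (l *: (1 : A)) y.
  move=> Df; apply/eqP; rewrite -subr_eq0; apply/eqP.
  apply: (@closure_min Y (E (2^-1 *: (f + l *: (1 : A))))
    [set q | (T f - T (l *: (1 : A))) q = 0]) (hy _ (Dm _ _ Df D1)).
    exact/closed_eqc/continuous_ua.
  move=> q /(Em _ _ Df D1) e.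
  by have /eqP := e; rewrite -subr_eq0 => /eqP.
set m : R[i] := T (l *: (1 : A)) y in Ty.
have m1 : normc m = 1.
  apply/eqP; rewrite eq_le; apply/andP; split; last first.
    rewrite -[m in leRHS]subr0.
    apply: (@closure_min Y (E (l *: (1 : A)))
      [set q | 1 <= normc (T (l *: (1 : A)) q - 0)]) (hy _ D1).
      exact/closed_dist_ge/continuous_ua.
    by move=> q [_] /=; rewrite subr0 => ->.
  exact: (sphere_le1 cY _ (T_sphere D1.1)).
have m0 := unimodular_neq0 m1.
(* The cluster point [y] may have left the boundary; the functions [m^-1 *: T f] all peak at it,
   hence also at some boundary point [q]. *)
have [|q bq hq] := @boundary_exists R Y cY B [set m^-1 *: T f | f in D] y.
  move=> _ [f Df <-]; split=> [z|]; rewrite uaE ?Ty ?mulVf//.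
  by rewrite normcM normcV m1 invr1 mul1r; exact: (sphere_le1 cY _ (T_sphere Df.1)).
exists q, m; split=> // f sf fp.
have [|_] := hq (m^-1 *: T f); first by exists f.
rewrite uaE => /(congr1 ( *%R m)); by rewrite mulVKf// mulr1.
Qed.

End SphereIsometry.

(** * Faces correspond to faces, and the pointwise form of the isometry *)

Section FacePreservation.
Context (R : realType) (X Y : topologicalType).
Context (cX : compact [set: X]) (cY : compact [set: Y]).
Context (A : uniformAlgebra R X) (B : uniformAlgebra R Y).
Context (T : A -> B) (T' : B -> A) (TT' : sphere_isometries T T').

Let T_sphere f (sf : ua_sphere A f) : ua_sphere B (T f).
Proof. by case: TT' => H _ _ _ _; exact: H. Qed.
Let T'_sphere g (sg : ua_sphere B g) : ua_sphere A (T' g).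
Proof. by case: TT' => _ H _ _ _; exact: H. Qed.
Let T_iso f g : ua_sphere A f -> ua_sphere A g ->
  supnorm (T f - T g) = supnorm (f - g).
Proof. by case: TT' => _ _ H _ _; exact: H. Qed.
Let T'_iso f g : ua_sphere B f -> ua_sphere B g ->
  supnorm (T' f - T' g) = supnorm (f - g).
Proof. by case: (sphere_isometries_sym TT') => _ _ H _ _; exact: H. Qed.
Let TK f : ua_sphere A f -> T' (T f) = f.
Proof. by case: TT' => _ _ _ H _; exact: H. Qed.
Let T'K g : ua_sphere B g -> T (T' g) = g.
Proof. by case: TT' => _ _ _ _; exact. Qed.

(** Mapping the receiving face back by [T'] lands in a face of [A] that contains the initial one;
    the two coincide by [face_unique], so the inclusion is an equality. *)
Lemma face_preserved p (l : R[i]) : boundary A p -> normc l = 1 ->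
  exists q (m : R[i]), [/\ boundary B q, normc m = 1 &
    forall f, ua_sphere A f -> f p = l <-> T f q = m].
Proof.
move=> bp l1; have [q [m [bq m1 Hq]]] := face_image cX cY TT' bp l1.
have [p' [l' [bp' l1' Hp]]] := face_image cY cX (sphere_isometries_sym TT') bq m1.
have H f : ua_sphere A f -> f p = l -> f p' = l'.
  by move=> sf fp; rewrite -(TK sf); apply: Hp; [exact: T_sphere|exact: Hq].
have pE := face_unique cX bp l1 H.
have lE : l' = l.
  have := H _ (cst_sphere cX A p l1); rewrite !uaE mulr1 => /(_ erefl) <-.
  by [].
exists q, m; split=> // f sf; split=> [|Tfq]; first exact: Hq.
by rewrite -(TK sf) -lE -pE; apply: Hp => //; exact: T_sphere.
Qed.

(** Elements of the faces at [p] with values [l] and [l'] are at distance at least [|l - l'|],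
    whereas faces at distinct points contain elements at distance close to 1. So [|l - l'| > 1]
    forces the same image point. *)
Lemma face_base_point p : boundary A p ->
  exists q (s : R[i] -> R[i]), boundary B q /\ forall l, normc l = 1 ->
    normc (s l) = 1 /\ forall f, ua_sphere A f -> f p = l <-> T f q = s l.
Proof.
move=> bp.
have [l|F hF] := @choice R[i] (Y * R[i]) (fun l qm => normc l = 1 ->
    [/\ boundary B qm.1, normc qm.2 = 1 &
    forall f, ua_sphere A f -> f p = l <-> T f qm.1 = qm.2]).
  have [l1|l1] := pselect (normc l = 1).
    by have [q [m H]] := face_preserved bp l1; exists (q, m).
  have [q [m _]] := face_preserved bp (normc1 R).
  by exists (q, m) => /l1.
have far l l' : normc l = 1 -> normc l' = 1 -> 1 < normc (l - l') ->
    (F l).1 = (F l').1.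
  move=> l1 l1' ll'; apply: contrapT => neq.
  have [b1 m1 H1] := hF _ l1; have [b2 m2 H2] := hF _ l1'.
  pose e := (normc (l - l') - 1) / 2.
  have e0 : 0 < e by rewrite divr_gt0// subr_gt0.
  have [g [g' [sg sg' gq gq' gg']]] := face_far cY b1 b2 neq m1 m2 e0.
  have gp : T' g p = l by apply/(H1 _ (T'_sphere sg)); rewrite T'K.
  have gp' : T' g' p = l' by apply/(H2 _ (T'_sphere sg')); rewrite T'K.
  have := ler_supnorm cX (T' g - T' g') p.
  by rewrite !uaE gp gp' T'_iso//; move: gg'; rewrite /e; lra.
have n1 : normc (1 : R[i]) = 1 := normc1 R.
have nN1 : normc (- 1 : R[i]) = 1 by rewrite normc_opp.
have e1 : (F (-1)).1 = (F 1).1.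
  apply: far => //; rewrite -opprD normc_opp.
  by have := normc_half R; rewrite normcV => /invr_inj ->; rewrite ltr1n.
(* Every [l] on the circle is at distance more than 1 from 1 or from -1, by the parallelogram
   law. *)
have eF l : normc l = 1 -> (F l).1 = (F 1).1.
  move=> l1; have [h|h] := ltP 1 (normc (l - 1)); first exact: far.
  rewrite -e1; apply: far => //.
  have pl : normc (l - 1) ^+ 2 + normc (l - - 1) ^+ 2 = 2 * normc l ^+ 2 + 2.
    by rewrite !sqr_normc !ReImE/=; ring.
  rewrite l1 in pl; have := normc_ge0 (l - 1); have := normc_ge0 (l - - 1).
  move=> h1 h2; rewrite ltNge; apply/negP => h3; nra.
exists (F 1).1, (fun l => (F l).2); split; first by have [] := hF _ n1.
by move=> l l1; have [_ h1 h2] := hF _ l1; rewrite -(eF _ l1).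
Qed.

(** The map [s] is an isometry of the circle, and [T] matches the distances from [f] to the faces at
    [p] with those from [T f] to the faces at [q]; these distances determine the value at the
    point. *)
Lemma sphere_isometry_pointwise p : boundary A p ->
  exists q (t : R[i]) b, [/\ boundary B q, normc t = 1 &
    forall f, ua_sphere A f -> T f q = t * conj_if b (f p)].
Proof.
move=> bp; have [q [s [bq Hs]]] := face_base_point bp.
have s1 l : normc l = 1 -> normc (s l) = 1 by move=> /Hs[].
have sP l f : normc l = 1 -> ua_sphere A f -> f p = l -> T f q = s l.
  by move=> /Hs[_ H] sf /(H _ sf).
have sP' l g : normc l = 1 -> ua_sphere B g -> g q = s l -> T' g p = l.
  by move=> /Hs[_ H] sg gq; apply/(H _ (T'_sphere sg)); rewrite T'K.
(* Constants lie in the faces: those of [A] give one inequality through [T], those of [B] the other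
   through [T']. *)
have [l m l1 m1|b sb] := circle_isometry s1.
  have sl := cst_sphere cX A p l1; have sm := cst_sphere cX A p m1.
  have sl' := cst_sphere cY B q (s1 _ l1).
  have sm' := cst_sphere cY B q (s1 _ m1).
  apply/eqP; rewrite eq_le; apply/andP; split.
    have := ler_supnorm cY (T (l *: (1 : A)) - T (m *: (1 : A))) q.
    rewrite !uaE (sP l) ?(sP m)// ?uaE ?mulr1// T_iso//; move/le_trans; apply.
    by apply: supnorm_le => [|x]; rewrite ?normc_ge0// !uaE !mulr1.
  have := ler_supnorm cX (T' (s l *: (1 : B)) - T' (s m *: (1 : B))) p.
  rewrite !uaE (sP' l) ?(sP' m)// ?uaE ?mulr1// T'_iso//; move/le_trans; apply.
  by apply: supnorm_le => [|x]; rewrite ?normc_ge0// !uaE !mulr1.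
have n1 : normc (1 : R[i]) = 1 := normc1 R.
exists q, (s 1), b; split=> // [|f sf]; first exact: s1.
have t0 := unimodular_neq0 (s1 _ n1).
(* The value that [f p] must have if the formula holds. *)
pose w := conj_if b ((s 1)^-1 * (T f q : R[i])).
have wd l : normc l = 1 -> normc (w - l) = normc (T f q - s l).
  move=> l1; rewrite -(normc_conj_if b) conj_ifD conj_ifN conj_ifK.
  have -> : (T f q : R[i]) - s l = s 1 * ((s 1)^-1 * (T f q : R[i]) - conj_if b l).
    by rewrite (sb _ l1) mulrBr mulVKf.
  by rewrite normcM s1// mul1r.
suff <- : w = f p by rewrite conj_ifK mulVKf.
have le_eps (a c : R) : (forall e, 0 < e -> a <= c + e) -> a <= c.
  by move=> H; apply/ler_addgt0Pr.
apply: eq_from_distances => [||l l1|l l1].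
- exact: sphere_le1.
- rewrite normc_conj_if normcM normcV s1// invr1 mul1r.
  exact: (sphere_le1 cY _ (T_sphere sf)).
- rewrite wd//; apply: le_eps => e e0.
  have [g [sg gp fg]] := face_near cX sf bp l1 e0.
  apply: le_trans fg; rewrite -T_iso// -(sP _ _ l1 sg gp).
  by rewrite -[_ - _]/((T f - T g) q); exact: ler_supnorm.
- rewrite wd//; apply: le_eps => e e0.
  have [g [sg gq fg]] := face_near cY (T_sphere sf) bq (s1 _ l1) e0.
  apply: le_trans fg; rewrite -T'_iso//; last exact: T_sphere.
  rewrite TK// -[l in leLHS](sP' _ _ l1 sg gq).
  by rewrite -[_ - _]/((f - T' g) p); exact: ler_supnorm.
Qed.

End FacePreservation.

(** * Characters and the Gelfand topology *)

Section Characters.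
Context (R : realType) (X : topologicalType) (A : uniformAlgebra R X).
Implicit Types (f g : A) (psi : maxIdealSpace A).

Lemma misD psi f g : psi (f + g) = (psi f : R[i]) + (psi g : R[i]).
Proof. by have := mis_linear psi 1 f g; rewrite !scale1r. Qed.

Lemma mis0 psi : psi 0 = (0 : R[i]).
Proof. by apply: (@addIr R[i] (psi 0)); rewrite -misD !add0r. Qed.

Lemma misZ psi (c : R[i]) f : psi (c *: f) = c * (psi f : R[i]).
Proof.
by have := mis_linear psi c f 0; rewrite !addr0 mis0 => ->; rewrite addr0.
Qed.

Lemma misM psi f g : psi (f * g) = (psi f : R[i]) * (psi g : R[i]).
Proof. exact: mis_mul. Qed.

Lemma mis1 psi : psi 1 = (1 : R[i]).
Proof.
have [f /eqP f0] := mis_neq0 psi.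
by apply: (@mulfI R[i] _ f0); rewrite -misM !mulr1.
Qed.

Lemma mis_nonempty psi : exists x : X, True.
Proof.
apply: contrapT => X0; have [f] := mis_neq0 psi; apply.
by rewrite -(mis0 psi); congr (psi _); apply: ua_eqP => x; case: X0; exists x.
Qed.

Lemma mis_eqP psi psi' : (forall f, psi f = psi' f) -> psi = psi'.
Proof.
case: psi psi' => [a a1 a2 a3] [b b1 b2 b3] /= /funext ab.
by subst b; congr MaxIdealSpace; exact: Prop_irrelevance.
Qed.

Lemma continuous_gelfand f : continuous (fun psi : maxIdealSpace A => psi f).
Proof.
move=> psi.
apply: (@continuous_comp _ _ _
  (@mis_fun R X A : maxIdealSpace A -> {ptws A -> R[i]^o}) (fun h => h f)).
  exact: initial_continuous.
exact: (@proj_continuous _ (fun _ => R[i]^o) f).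
Qed.

Lemma continuous_to_mis (M : topologicalType) (F : M -> maxIdealSpace A) :
  (forall f, continuous (fun m => F m f)) -> continuous F.
Proof.
move=> cF; apply: continuous_comp_initial => m; apply/cvg_sup => f.
move: m.
apply: (@continuous_comp_initial _ M R[i]^o (fun g : A -> R[i]^o => g f)).
exact: cF.
Qed.

(* [1 / (1 - g)] is the uniform limit of the partial sums of its Neumann series. *)
Lemma ua_invert_near1 (g : A) (r : R) : 0 <= r -> r < 1 ->
  (forall x, normc (g x) <= r) -> exists k : A, k * (1 - g) = 1.
Proof.
move=> r0 r1 gr; pose s := 1 - r; have s0 : 0 < s by rewrite subr_gt0.
pose u x : R[i] := 1 - (g x : R[i]).
have us x : s <= normc (u x).
  have := ler_normcD (u x) (g x); rewrite subrK normc1; have := gr x.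
  by rewrite /s; lra.
have u0 x : u x != 0 by rewrite -normc_eq0 gt_eqF// (lt_le_trans s0).
have [||k hk] := @ua_of_fun R X A (fun x => (u x)^-1 : R[i]^o).
- apply/continuous_normcP => x e e0.
  have d0 : 0 < e * (s * s) by rewrite !mulr_gt0.
  have /continuous_normcP/(_ x _ d0) := @continuous_ua R X A g.
  apply: filterS => y hy.
  have -> : (u y)^-1 - (u x)^-1 = (g y - g x) * ((u y)^-1 * (u x)^-1).
    have -> : (g y : R[i]) - (g x : R[i]) = u x - u y by rewrite /u; ring.
    by field; rewrite !u0.
  rewrite !normcM !normcV -invfM ltr_pdivrMr; last first.
    by rewrite mulr_gt0// (lt_le_trans s0).
  by apply: lt_le_trans hy _; rewrite ler_pM2l// ler_pM// ltW.
- move=> e e0; have [|n hn] := @exprn_small R r (e * s) r0 r1.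
    by rewrite mulr_gt0.
  exists (\sum_(j < n) g ^+ j) => x; rewrite uaE.
  have E : u x * \sum_(j < n) (g ^+ j) x = 1 - (g x : R[i]) ^+ n.
    have -> : 1 - (g x : R[i]) ^+ n = - ((g x : R[i]) ^+ n - 1) by rewrite opprB.
    rewrite subrX1 -mulNr opprB; congr (_ * _).
    by apply: eq_bigr => j _; rewrite uaX.
  have -> : (u x)^-1 - \sum_(j < n) (g ^+ j) x = (u x)^-1 * (g x : R[i]) ^+ n.
    apply: (mulfI (u0 x)); rewrite mulrBr E mulVKf// divff//.
    by rewrite opprB addrC subrK.
  rewrite normcM normcV normcX mulrC ler_pdivrMr ?(lt_le_trans s0)//.
  apply: (@le_trans _ _ (r ^+ n)).
    by rewrite lerXn2r ?nnegrE ?normc_ge0.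
  apply: le_trans (ltW hn) _; rewrite ler_pM2l//.
by exists k; apply: ua_eqP => x; rewrite !uaE hk mulVf.
Qed.

(** Otherwise [f / psi f] has norm less than 1, so [1 - f / psi f] is invertible, although [psi]
    vanishes on it. *)
Lemma mis_le psi f : compact [set: X] -> normc (psi f) <= supnorm f.
Proof.
move=> cX; rewrite leNgt; apply/negP => lt.
have p0 : 0 < normc (psi f) by apply: le_lt_trans lt; exact: supnorm_ge0.
have psi0 : (psi f : R[i]) != 0 by rewrite -normc_eq0 gt_eqF.
pose r := supnorm f / normc (psi f).
have [|||k hk] := @ua_invert_near1 ((psi f : R[i])^-1 *: f) r.
- by rewrite divr_ge0 ?supnorm_ge0// ltW.
- by rewrite ltr_pdivrMr ?mul1r.
- move=> x; rewrite uaE normcM normcV mulrC ler_pM2r ?invr_gt0//.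
  exact: ler_supnorm.
have := congr1 psi hk; rewrite misM misD mis1 -scaleN1r !misZ mulVf// mulr1.
by rewrite subrr mulr0 => /esym/eqP; rewrite oner_eq0.
Qed.

Lemma mis_inverse_unimodular psi f g : compact [set: X] ->
  supnorm f <= 1 -> supnorm g <= 1 -> f * g = 1 -> normc (psi f) = 1.
Proof.
move=> cX f1 g1 fg; have := congr1 (fun h => normc (psi h)) fg.
rewrite misM mis1 normcM normc1.
have := le_trans (mis_le psi f cX) f1; have := le_trans (mis_le psi g cX) g1.
have := normc_ge0 (psi f); have := normc_ge0 (psi g).
by move=> g0 f0 g1' f1' e; apply/eqP; rewrite eq_le f1'/=; nra.
Qed.

End Characters.

(* A real-linear unital ring morphism [S] sends ['i] to a square root of [-1], so
   a character composed with [S] is complex-linear or conjugate-linear. *)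
Section CharacterTransport.
Context (R : realType) (X Y : topologicalType).
Context (A : uniformAlgebra R X) (B : uniformAlgebra R Y) (S : A -> B).
Context (S1 : S 1 = 1) (SM : forall f g : A, S (f * g) = S f * S g).
Context (SL : real_linear S).
Implicit Types (psi : maxIdealSpace B).

Definition ua_i (Z : topologicalType) (C : uniformAlgebra R Z) : C :=
  ('i%C : R[i]) *: (1 : C).

Definition anti psi : bool := psi (S (ua_i A)) != ('i%C : R[i]).

Let SD (f g : A) : S (f + g) = S f + S g.
Proof. by have := SL 1 f g; rewrite rmorph1 !scale1r. Qed.

Let S0 : S 0 = 0.
Proof. by apply: (@addIr _ (S 0)); rewrite -SD !add0r. Qed.

Let SZ (r : R) (f : A) : S (r%:C%C *: f) = r%:C%C *: S f.
Proof. by have := SL r f 0; rewrite !addr0 S0 addr0. Qed.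

Lemma transport_iE psi :
  (psi (S (ua_i A)) : R[i]) = conj_if (anti psi) 'i%C.
Proof.
have : (psi (S (ua_i A)) : R[i]) ^+ 2 = 'i%C ^+ 2.
  rewrite expr2 -misM -SM.
  have -> : ua_i A * ua_i A = (-1 : R)%:C%C *: (1 : A).
    apply: ua_eqP => x; rewrite !uaE !mulr1.
    by apply: complex_eqP => /=; ring.
  rewrite SZ S1 misZ mis1 mulr1; apply: complex_eqP => /=; ring.
rewrite /anti; case: eqVneq => //= ni /eqP; rewrite eqf_sqr (negbTE ni)/= => /eqP ->.
by apply: complex_eqP => //=; rewrite ?oppr0.
Qed.

Definition transport_fun psi (f : A) : R[i]^o := conj_if (anti psi) (psi (S f)).

Lemma transport_linear psi : linear (transport_fun psi).
Proof.
move=> c f g; rewrite /transport_fun.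
(* Only real scalars pass through [S]; the imaginary part is written as a product with [ua_i A],
   which multiplicativity handles. *)
have -> : c *: f + g = (complex.Re c)%:C%C *: f
    + ((complex.Im c)%:C%C *: (ua_i A * f) + g).
  apply: ua_eqP => x; rewrite !uaE mulr1 addrA; congr (_ + _).
  by apply: complex_eqP; rewrite !ReImE/=; ring.
rewrite !SL SM misD misZ misD misZ misM transport_iE.
rewrite !(conj_ifD, conj_ifM) !conj_ifR conj_ifK.
rewrite addrA mulrA -mulrDl; congr (_ * _ + _).
by apply: complex_eqP; rewrite !ReImE/=; ring.
Qed.

Lemma transport_mul psi : {morph transport_fun psi : f g / f * g}.
Proof. by move=> f g; rewrite /transport_fun SM misM conj_ifM. Qed.

Lemma transport_neq0 psi : exists f, transport_fun psi f <> 0.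
Proof.
exists 1; rewrite /transport_fun S1 mis1 => /(congr1 (@normc R)).
by rewrite normc_conj_if normc1 normc0 => /eqP; rewrite oner_eq0.
Qed.

Definition transport psi : maxIdealSpace A :=
  MaxIdealSpace (transport_linear psi) (transport_mul psi) (transport_neq0 psi).

Lemma transportE psi f : transport psi f = conj_if (anti psi) (psi (S f)).
Proof. by []. Qed.

(** The Gelfand transform of [S (ua_i A)] takes only the values ['i] and [- 'i], so its two level
    sets are closed and complementary. *)
Lemma clopen_anti b : clopen [set psi | anti psi = b].
Proof.
have cl b' : closed [set psi | anti psi = b'].
  have -> : [set psi | anti psi = b']
      = [set psi : maxIdealSpace B | psi (S (ua_i A)) = conj_if b' 'i%C].
    apply/seteqP; split=> psi /=; first by move<-; exact: transport_iE.
    rewrite /anti => ->; case: b' => /=; last by rewrite eqxx.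
    apply/eqP => /(congr1 (@complex.Im R))/= e.
    by move: e; lra.
  exact/closed_eqc/continuous_gelfand.
split=> //; rewrite -closedC.
have -> : ~` [set psi | anti psi = b] = [set psi | anti psi = ~~ b].
  by apply/seteqP; split=> psi /=; case: (anti psi); case: b.
exact: cl.
Qed.

Lemma continuous_transport : continuous transport.
Proof.
apply: continuous_to_mis => f; apply/continuous_normcP => psi e e0.
have /continuous_normcP/(_ psi e e0) := @continuous_gelfand R Y B (S f).
have [oa _] := clopen_anti (anti psi).
(* Near [psi] the same conjugation applies, so the distances reduce to those of a Gelfand
   transform. *)
have : \forall phi \near psi, anti phi = anti psi by exact: (open_nbhs_nbhs (conj oa _)).
apply: filterS2 => phi ea hphi.
by rewrite !transportE ea -conj_ifN -conj_ifD normc_conj_if.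
Qed.

End CharacterTransport.

(** Evaluation at [S (ua_i A)] shows that the transported character has the same type as [chi]; the
    two conjugations then cancel. *)
Lemma transportK (R : realType) (X Y : topologicalType)
    (A : uniformAlgebra R X) (B : uniformAlgebra R Y) (S : A -> B) (S' : B -> A)
    (S1 : S 1 = 1) (SM : forall f g : A, S (f * g) = S f * S g) (SL : real_linear S)
    (S'1 : S' 1 = 1) (S'M : forall f g : B, S' (f * g) = S' f * S' g)
    (S'L : real_linear S') : cancel S S' ->
  cancel (transport S'1 S'M S'L) (transport S1 SM SL).
Proof.
move=> SK chi; apply: mis_eqP => f; rewrite !transportE SK.
have -> : anti S (transport S'1 S'M S'L chi) = anti S' chi.
  rewrite /anti transportE SK -/(anti S' chi) /ua_i misZ mis1 mulr1.
  case: (anti S' chi) => /=; last by rewrite eqxx.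
  apply/eqP => /(congr1 (@complex.Im R))/= e.
  by move: e; lra.
by rewrite conj_ifK.
Qed.

(** * The positively homogeneous extension *)

Section HomogeneousExtension.
Context (R : realType) (X Y : topologicalType).
Context (cX : compact [set: X]) (cY : compact [set: Y]).
Context (A : uniformAlgebra R X) (B : uniformAlgebra R Y).

(** At [f = 0] the outer factor vanishes, so the value is 0 whatever [T 0] is. *)
Definition homogeneous_ext (T : A -> B) (f : A) : B :=
  (supnorm f)%:C%C *: T ((supnorm f)^-1%:C%C *: f).

Lemma normalize_sphere (f : A) : supnorm f != 0 ->
  ua_sphere A ((supnorm f)^-1%:C%C *: f).
Proof.
move=> f0; rewrite /ua_sphere/= supnormZ// normcR ger0_norm ?mulVf//.
by rewrite invr_ge0 supnorm_ge0.
Qed.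

Lemma homogeneous_ext_sphere (T : A -> B) f : ua_sphere A f ->
  homogeneous_ext T f = T f.
Proof. by move=> f1; rewrite /homogeneous_ext f1 invr1 rmorph1 !scale1r. Qed.

Lemma homogeneous_ext_pointwise (T : A -> B) p q (t : R[i]) b :
  (forall f, ua_sphere A f -> T f q = t * conj_if b (f p)) ->
  forall f, homogeneous_ext T f q = t * conj_if b (f p).
Proof.
move=> HT f; rewrite /homogeneous_ext uaE.
have [f0|f0] := eqVneq (supnorm f) 0.
  by rewrite f0 rmorph0 mul0r (supnorm_eq0 cX f0) ua0 (conj_ifR b 0) mulr0.
rewrite HT; last exact: normalize_sphere.
rewrite uaE conj_ifM conj_ifR mulrCA [X in _ * X]mulrA -rmorphM divff// mul1r.
by [].
Qed.

End HomogeneousExtension.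

(** * Real-linearity of the extension and its ring structure *)

Section Extension.
Context (R : realType) (X Y : topologicalType).
Context (cX : compact [set: X]) (cY : compact [set: Y]).
Context (A : uniformAlgebra R X) (B : uniformAlgebra R Y).
Context (T : A -> B) (T' : B -> A) (TT' : sphere_isometries T T').

Let U := homogeneous_ext T.

Lemma ext_at_image p : boundary A p -> exists q (t : R[i]) b,
  [/\ boundary B q, normc t = 1 & forall f, U f q = t * conj_if b (f p)].
Proof.
move=> /(sphere_isometry_pointwise cX cY TT')[q [t [b [bq t1 H]]]].
by exists q, t, b; split=> // f; exact: homogeneous_ext_pointwise.
Qed.

(** The formula for [T'] at [q] is solved for [T f q]; in this way every boundary point of [B] is
    covered, not only the images of boundary points of [A]. *)
Lemma ext_at q : boundary B q -> exists p (t : R[i]) b,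
  [/\ boundary A p, normc t = 1 & forall f, U f q = t * conj_if b (f p)].
Proof.
move=> bq; have [Tf _ _ TK _] := TT'.
have [p [t [b [bp t1 H]]]] :=
  sphere_isometry_pointwise cY cX (sphere_isometries_sym TT') bq.
exists p, (conj_if b t^-1), b; split=> //.
  by rewrite normc_conj_if normcV t1 invr1.
move=> f; apply: homogeneous_ext_pointwise => // g sg.
have := H _ (Tf _ sg); rewrite TK// => ->.
by rewrite -conj_ifM mulKf ?unimodular_neq0// conj_ifK.
Qed.

Lemma ext_real_linear : real_linear U.
Proof.
move=> r f g; apply: (boundary_eqP cY) => q bq.
have [p [t [b [_ _ H]]]] := ext_at bq.
have -> : (r%:C%C *: U f + U g) q = r%:C%C * (U f q : R[i]) + (U g q : R[i]) by [].
by rewrite !H uaD uaZ conj_ifD conj_ifM conj_ifR; ring.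
Qed.

(** Norms are attained on the boundary; [ext_at] bounds the left side by the right, and
    [ext_at_image] gives the converse. *)
Lemma ext_isometry : isometry_on [set: A] U.
Proof.
move=> f g _ _; apply/eqP; rewrite eq_le; apply/andP; split.
  apply: (boundary_supnorm_le cY) => [|q bq]; first exact: supnorm_ge0.
  have [p [t [b [_ t1 H]]]] := ext_at bq.
  have -> : (U f - U g) q = t * conj_if b ((f - g) p).
    by rewrite uaD uaN !H uaD uaN conj_ifD conj_ifN; ring.
  by rewrite normcM t1 mul1r normc_conj_if; exact: ler_supnorm.
apply: (boundary_supnorm_le cX) => [|p bp]; first exact: supnorm_ge0.
have [q [t [b [_ t1 H]]]] := ext_at_image bp.
apply: le_trans (ler_supnorm cY (U f - U g) q).
have -> : (U f - U g) q = t * conj_if b ((f - g) p).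
  by rewrite uaD uaN !H uaD uaN conj_ifD conj_ifN; ring.
by rewrite normcM t1 mul1r normc_conj_if.
Qed.

Lemma ext_surj : set_surj [set: A] [set: B] U.
Proof.
move=> g _; have [_ T'f _ _ T'K] := TT'.
have [g0|g0] := eqVneq (supnorm g) 0.
  exists 0 => //; rewrite (supnorm_eq0 cY g0) /U /homogeneous_ext.
  by rewrite supnorm0// rmorph0 scale0r.
have sg := normalize_sphere cY g0; have sf := T'f _ sg.
set f := T' _ in sf; exists ((supnorm g)%:C%C *: f) => //.
have fE : supnorm ((supnorm g)%:C%C *: f) = supnorm g.
  by rewrite supnormZ// [supnorm f]sf mulr1 normcR ger0_norm ?supnorm_ge0.
rewrite /U /homogeneous_ext fE scalerA -rmorphM mulVf// rmorph1 scale1r.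
by rewrite /f T'K// scalerA -rmorphM divff// rmorph1 scale1r.
Qed.

Lemma ext_surjective_real_linear_isometry : surjective_real_linear_isometry U.
Proof.
by split; [exact: ext_real_linear|exact: ext_isometry|exact: ext_surj].
Qed.

(* If [U f = 1] then [U (f ^+ 2)] inverts [U 1], and [U 1]^-1 * U is a ring
   isomorphism, both by inspection on the boundary. *)
Lemma ext_factor : exists (v : B) (S : A -> B) (S' : B -> A),
  [/\ U 1 * v = 1, supnorm (U 1) <= 1 /\ supnorm v <= 1,
      forall f, U f = U 1 * S f, cancel S S' /\ cancel S' S &
      [/\ S 1 = 1, forall f g, S (f * g) = S f * S g & real_linear S]].
Proof.
have [f0 _ Uf0] : [set U f | f in [set: A]] 1 by exact: ext_surj.
(* At a boundary point [U f0 = 1] says that [f0 p], up to conjugation, is [t^-1]; hence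
   [U (f0 * f0)] takes the value [t t^-2 = t^-1]. *)
pose v := U (f0 * f0).
have vE q : boundary B q -> exists p (t : R[i]) b, [/\ normc t = 1,
    forall f, U f q = t * conj_if b (f p), U 1 q = t & t * (v q : R[i]) = 1].
  move=> bq; have [p [t [b [_ t1 H]]]] := ext_at bq.
  have e : t * conj_if b (f0 p) = 1 by rewrite -H Uf0 ua1.
  exists p, t, b; split=> //; first by rewrite H ua1 (conj_ifR b 1) mulr1.
  rewrite /v H uaM conj_ifM.
  by rewrite [X in t * X]mulrA e mul1r.
have uv : U 1 * v = 1.
  apply: (boundary_eqP cY) => q /vE[p [t [b [_ _ u1 tv]]]].
  by rewrite uaM u1 tv.
pose S f := v * U f.
have SE q : boundary B q -> exists p b, forall f, S f q = conj_if b (f p).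
  move=> /vE[p [t [b [_ H _ tv]]]]; exists p, b => f.
  by rewrite uaM H mulrA [X in X * _]mulrC tv mul1r.
(* The inverse of [S] picks a preimage of [U 1 * g] under [U]. *)
have [f|S' hS'] := @choice B A (fun g f => U f = U 1 * g).
  by have [g _ <-] := ext_surj (t := U 1 * f) I; exists g.
have UI f g : U f = U g -> f = g.
  move=> fg; apply/eqP; rewrite -subr_eq0; apply/eqP/(supnorm_eq0 cX).
  by rewrite -(ext_isometry (f := f) (g := g) I I) fg subrr supnorm0.
have US f : U f = U 1 * S f by rewrite mulrA uv mul1r.
exists v, S, S'; split=> //.
- split; apply: (boundary_supnorm_le cY) => // q /vE[p [t [b [t1 _ u1 tv]]]].
    by rewrite u1 t1.
  have := congr1 (@normc R) tv; rewrite normcM t1 mul1r normc1 => -> //.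
- split=> [f|g]; first by apply: UI; rewrite hS' -US.
  by rewrite /S hS' mulrA [v * _]mulrC uv mul1r.
- split=> [|f g|r f g]; apply: (boundary_eqP cY) => q /SE[p [b H]].
  + by rewrite H !ua1 (conj_ifR b 1).
  + by rewrite uaM !H uaM conj_ifM.
  + by rewrite uaD uaZ !H uaD uaZ conj_ifD conj_ifM conj_ifR.
Qed.

End Extension.

(** * The inverse isometry and the passage to maximal ideal spaces *)

Lemma sphere_isometry_inverse (R : realType) (X Y : topologicalType)
    (cX : compact [set: X]) (cY : compact [set: Y])
    (A : uniformAlgebra R X) (B : uniformAlgebra R Y) (T : A -> B) :
  set_fun (ua_sphere A) (ua_sphere B) T ->
  set_surj (ua_sphere A) (ua_sphere B) T -> isometry_on (ua_sphere A) T ->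
  exists T', sphere_isometries T T'.
Proof.
move=> Tf Ts Ti.
have [g|T' hT'] := @choice B A (fun g f => ua_sphere B g ->
    ua_sphere A f /\ T f = g).
  have [sg|sg] := pselect (ua_sphere B g); last by exists 0 => /sg.
  by have [f sf <-] := Ts _ sg; exists f.
exists T'; split=> // [g /hT'[]|f sf|g /hT'[]] //.
have [sf' Tf'] := hT' _ (Tf _ sf).
apply/eqP; rewrite -subr_eq0; apply/eqP/(supnorm_eq0 cX).
by rewrite -Ti// Tf' subrr supnorm0.
Qed.

Theorem theorem2p1 (R : realType) (X Y : topologicalType)
    (cX : compact [set: X]) (hX : hausdorff_space X)
    (cY : compact [set: Y]) (hY : hausdorff_space Y)
    (A : uniformAlgebra R X) (B : uniformAlgebra R Y)
    (T : A -> B)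
    (T_fun : set_fun (ua_sphere A) (ua_sphere B) T)
    (T_surj : set_surj (ua_sphere A) (ua_sphere B) T)
    (T_isom : isometry_on (ua_sphere A) T) :
  (exists U : A -> B,
     surjective_real_linear_isometry U /\ {in ua_sphere A, U =1 T}) /\
  (forall psi : maxIdealSpace B, `|psi (T 1)| = 1) /\
  exists (Psi : maxIdealSpace B -> maxIdealSpace A)
         (MBp MBm : set (maxIdealSpace B)),
    [/\ homeomorphism Psi,
        clopen MBp /\ clopen MBm,
        MBp `&` MBm = set0,
        MBp `|` MBm = [set: maxIdealSpace B] &
        exists Tt : A -> B,
          [/\ forall f psi, MBp psi -> psi (Tt f) = psi (T 1) * Psi psi f,
              forall f psi, MBm psi -> psi (Tt f) = psi (T 1) * (Psi psi f)^*,
              surjective_real_linear_isometry Tt &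
              {in ua_sphere A, Tt =1 T}]].
Proof.
have [T' TT'] := sphere_isometry_inverse cX cY T_fun T_surj T_isom.
have [v [S [S' [uv [u1 v1] US [SK S'K] [S1 SM SL]]]]] := ext_factor cX cY TT'.
set U := homogeneous_ext T in uv u1 US.
have UT : {in ua_sphere A, U =1 T}.
  by move=> f; rewrite inE; exact: homogeneous_ext_sphere.
have Uiso : surjective_real_linear_isometry U.
  exact: (ext_surjective_real_linear_isometry cX cY TT').
(* [U] and [T] agree at 1 only if 1 has norm 1, that is, if [X] is nonempty. A character of [B]
   supplies a point of [Y], and surjectivity of [T] then one of [X]. *)
have U1 (psi : maxIdealSpace B) : U 1 = T 1.
  have [y _] := mis_nonempty psi.
  have [f sf _] := T_surj _ (cst_sphere cY B y (normc1 R)).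
  have [x _] := sphere_point cX sf.
  apply: UT; rewrite inE.
  by have := cst_sphere cX A x (normc1 R); rewrite scale1r.
have S'1 : S' 1 = 1 by rewrite -S1 SK.
have S'M f g : S' (f * g) = S' f * S' g.
  by apply: (can_inj SK); rewrite SM !S'K.
have S'L : real_linear S'.
  by move=> r f g; apply: (can_inj SK); rewrite SL !S'K.
split; first by exists U.
split.
  move=> psi; rewrite -(U1 psi) norm_normc.
  by rewrite (mis_inverse_unimodular psi cY u1 v1 uv).
exists (transport S1 SM SL), [set psi | anti S psi = false],
  [set psi | anti S psi = true]; split.
- split; first exact: continuous_transport.
  exists (transport S'1 S'M S'L); split; first exact: continuous_transport.
    exact: transportK.
  exact: transportK.
- by split; exact: clopen_anti.
- by rewrite -subset0 => psi [] /= ->.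
- by apply/seteqP; split=> // psi _ /=; case: (anti S psi); [right|left].
(* From [U f = U 1 * S f], the value of [psi] is [psi (T 1)] times [psi (S f)], which is [Psi psi f]
   up to the conjugation that [anti] records. *)
exists U; split=> // f psi a.
  by rewrite US misM (U1 psi) transportE a.
by rewrite US misM (U1 psi) transportE a /= conjCK.
Qed.
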